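(* There is a computably enumerable set $A\subseteq\omega$ that is intermediate for $\Delta$-Feiner.
   Context: $X^{(m)}$ denotes the $m$th Turing jump of $X$, with $X^{(-1)}=X^{(0)}=X$. Fix $a,b\in\omega$ with $b\geq 1$. For $X\subseteq\omega$, a set $S\subseteq\omega$ is $\Delta^0_{(bn+a)}(X)$ if there is a single Turing functional $\Phi_e$ such that for all $n$, $\Phi_e^{X^{(bn+a-1)}}(n)$ converges, with value $1$ if $n\in S$ and $0$ if $n\notin S$. A set $X$ is low for $\Delta^0_{(bn+a)}$ if every $S$ that is $\Delta^0_{(bn+a)}(X)$ is also $\Delta^0_{(bn+a)}(\emptyset)$; it is high for $\Delta^0_{(bn+a)}$ if every $S$ that is $\Delta^0_{(bn+a)}(\emptyset')$ is also $\Delta^0_{(bn+a)}(X)$; it is intermediate for $\Delta^0_{(bn+a)}$ if it is neither low nor high for $\Delta^0_{(bn+a)}$. A set is intermediate for $\Delta$-Feiner if it is intermediate for $\Delta^0_{(bn+a)}$ for some $a,b\in\omega$ with $b\geq 1$. *)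

(* Defs.v *)
From Stdlib Require Import Arith Lia Cantor.

Notation "⟨ x , y ⟩" := (Cantor.to_nat (x, y)) (at level 0, format "⟨ x ,  y ⟩").

(** Subsets of ω.  They are arbitrary propositions because the sets of interest
    (jumps) are not decidable. *)
Definition nset := nat -> Prop.

Definition empty_set : nset := fun _ => False.

(** Relativized partial recursive functions are generated as unary functions on
    ω, with several arguments passed through the Cantor pairing. *)
Inductive code : Type :=
| Oracle
| Zero
| Succ
| Fst
| Snd
| Pair (f g : code)
| Comp (f g : code)
| Prec (f g : code)
| Mu (f : code).

(** Graph of the [h] given by [h 0 = f a] and [h (n+1) = g ⟨a, ⟨n, h n⟩⟩], for
    partial functions with graphs [F] and [G]. *)
Fixpoint prec_graph (F G : nat -> nat -> Prop) (a n y : nat) : Prop :=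
  match n with
  | 0 => F a y
  | S k => exists r, prec_graph F G a k r /\ G ⟨a, ⟨k, r⟩⟩ y
  end.

(** [eval X c x y]: with oracle [X], the computation of [c] on input [x]
    converges with output [y]. *)
Fixpoint eval (X : nset) (c : code) (x y : nat) : Prop :=
  match c with
  | Oracle => (X x /\ y = 1) \/ (~ X x /\ y = 0)
  | Zero => y = 0
  | Succ => y = S x
  | Fst => y = fst (Cantor.of_nat x)
  | Snd => y = snd (Cantor.of_nat x)
  | Pair f g => exists u v, eval X f x u /\ eval X g x v /\ y = ⟨u, v⟩
  | Comp f g => exists u, eval X g x u /\ eval X f u y
  | Prec f g =>
      prec_graph (eval X f) (eval X g)
        (fst (Cantor.of_nat x)) (snd (Cantor.of_nat x)) y
  | Mu f =>
      eval X f ⟨x, y⟩ 0 /\ forall i, i < y -> exists v, eval X f ⟨x, i⟩ (S v)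
  end.

Fixpoint encode (c : code) : nat :=
  match c with
  | Oracle => 0
  | Zero => 1
  | Succ => 2
  | Fst => 3
  | Snd => 4
  | Pair f g => 5 + 4 * ⟨encode f, encode g⟩
  | Comp f g => 6 + 4 * ⟨encode f, encode g⟩
  | Prec f g => 7 + 4 * ⟨encode f, encode g⟩
  | Mu f => 8 + 4 * encode f
  end.

(** [Phi e X x y] is Φ_e^X(x)↓ = y.  By [encode_inj] and [encode_surj] below,
    [e] is the index of exactly one code. *)
Definition Phi (e : nat) (X : nset) (x y : nat) : Prop :=
  exists c, encode c = e /\ eval X c x y.

Definition ce (A : nset) : Prop :=
  exists e, forall n, A n <-> exists y, Phi e empty_set n y.

Definition jump (X : nset) : nset := fun e => exists y, Phi e X e y.

(** The [m]th Turing jump X^(m). *)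
Definition jumps (m : nat) (X : nset) : nset := Nat.iter m jump X.

(** Δ⁰_(bn+a)(X).  The subtraction is the truncated one of [nat], so for
    [b * n + a = 0] it yields X^(0) = X, which is the convention X^(-1) = X. *)
Definition Delta (a b : nat) (X S : nset) : Prop :=
  exists e, forall n,
    (S n -> Phi e (jumps (b * n + a - 1) X) n 1) /\
    (~ S n -> Phi e (jumps (b * n + a - 1) X) n 0).

Definition low_for_Delta (a b : nat) (X : nset) : Prop :=
  forall S, Delta a b X S -> Delta a b empty_set S.

Definition high_for_Delta (a b : nat) (X : nset) : Prop :=
  forall S, Delta a b (jump empty_set) S -> Delta a b X S.

Definition intermediate_for_Delta (a b : nat) (X : nset) : Prop :=
  ~ low_for_Delta a b X /\ ~ high_for_Delta a b X.

Definition intermediate_for_Delta_Feiner (X : nset) : Prop :=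
  exists a b, b >= 1 /\ intermediate_for_Delta a b X.

Lemma encode_inj c d : encode c = encode d -> c = d.
Proof.
assert (P : forall a b a' b', ⟨a, b⟩ = ⟨a', b'⟩ -> a = a' /\ b = b').
{ intros a b a' b' H. apply Cantor.to_nat_inj in H. now inversion H. }
revert d; induction c; destruct d; cbn [encode]; intros H;
  try reflexivity; try lia.
all: try (match type of H with _ + 4 * ?u = _ + 4 * ?v =>
  assert (E : u = v) by lia end).
all: try (apply P in E; destruct E).
all: f_equal; auto.
Qed.

Lemma encode_surj e : exists c, encode c = e.
Proof.
induction e as [e IH] using lt_wf_ind.
destruct (le_lt_dec 5 e) as [He|He].
2:{ destruct e as [|[|[|[|[|]]]]]; [exists Oracle|exists Zero|exists Succ|
    exists Fst|exists Snd|lia]; reflexivity. }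
pose (q := (e - 5) / 4). pose (r := (e - 5) mod 4).
assert (E : e - 5 = 4 * q + r) by apply Nat.div_mod_eq.
assert (R : r < 4) by (apply Nat.mod_upper_bound; lia).
assert (Q : exists f g, ⟨encode f, encode g⟩ = q).
{ pose proof (Cantor.cancel_to_of q) as C.
  destruct (Cantor.of_nat q) as [u v] eqn:D.
  pose proof (Cantor.to_nat_non_decreasing u v).
  destruct (IH u) as [f <-]; [lia|]. destruct (IH v) as [g <-]; [lia|].
  now exists f, g. }
destruct Q as (f & g & Q). destruct (IH q) as [h Hh]; [lia|].
clearbody q r.
destruct r as [|[|[|[|]]]];
  [exists (Pair f g)|exists (Comp f g)|exists (Prec f g)|exists (Mu h)|lia];
  cbn [encode]; lia.
Qed.

Lemma eval_fun X c x y z : eval X c x y -> eval X c x z -> y = z.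
Proof.
revert x y z; induction c as [| | | | |f IHf g IHg|f IHf g IHg|f IHf g IHg|f IHf];
  cbn [eval]; intros x y z; try congruence.
- intros [[? ->]|[? ->]] [[? ->]|[? ->]]; tauto.
- intros (u & v & Hu & Hv & ->) (u' & v' & Hu' & Hv' & ->).
  now rewrite (IHf _ _ _ Hu Hu'), (IHg _ _ _ Hv Hv').
- intros (u & Hu & Hy) (u' & Hu' & Hz).
  rewrite (IHg _ _ _ Hu Hu') in Hy. eauto.
- generalize (fst (Cantor.of_nat x)), (snd (Cantor.of_nat x)); clear x.
  intros a n; revert y z; induction n as [|n IHn]; cbn [prec_graph]; intros y z.
  + apply IHf.
  + intros (r & Hr & Hy) (r' & Hr' & Hz).
    rewrite (IHn _ _ Hr Hr') in Hy. eauto.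
- intros [Hy My] [Hz Mz].
  destruct (lt_eq_lt_dec y z) as [[L|E]|L]; [|exact E|].
  + destruct (Mz _ L) as [v Hv]. discriminate (IHf _ _ _ Hy Hv).
  + destruct (My _ L) as [v Hv]. discriminate (IHf _ _ _ Hz Hv).
Qed.

Lemma Phi_fun e X x y z : Phi e X x y -> Phi e X x z -> y = z.
Proof.
intros (c & <- & Hy) (d & E & Hz). apply encode_inj in E; subst d.
exact (eval_fun _ _ _ _ _ Hy Hz).
Qed.

(* Main.v *)
From Stdlib Require Import Arith Lia Cantor Bool ClassicalEpsilon.
Require Import Defs.

(** The witness [A] is the level just above ∅ of a tower
      ∅ = X_0, A = X_1, X_2, X_3, ...
    in which, uniformly in [k],
    - X_(k+1) is X_k joined with a set c.e. in X_k;
    - X_(k+2) is Turing equivalent to the jump of X_k;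
    - X_(k+1) decides one prescribed Σ_1 question about X_k.
    By the second clause X_(2m) and X_(2m+1) are, uniformly in [m], equivalent to the
    [m]th jumps of ∅ and of [A].  So the third clause says that A^(m) decides one
    Σ_1 question about ∅^(m), and that ∅^(m+1) decides one Σ_1 question about A^(m).
    Take the question to be whether Φ_m(m) = 0 with oracle ∅^(m), respectively A^(m).
    The set of those [m] for which the answer is positive differs at [m] from
    everything that Φ_m computes from the [m]th jump of ∅, respectively of [A].  Hence
    the first set is Δ(A) but not Δ(∅), and the second is Δ(∅') but not Δ(A), for
    a = b = 1: [A] is neither low nor high.

    One step of the tower is a pseudojump inversion in the manner of Jockusch and Shore.
    Given [X] and an operator [Y ↦ W^Y], a finite injury construction c.e. in [X] builds
    [B] such that X' is equivalent to (X ⊕ B) ⊕ W^(X ⊕ B).  The elements of X'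
    are coded into [B] by markers, and the [i]th marker moves only in order to protect
    the computations that put some [j < i] into [W].  Knowing [W], one knows when the
    markers have stopped ([source_stage]); knowing X', one knows when the computations
    are safe ([outcome_iff_found]).  The 0th marker never moves, so it may be used to
    code the prescribed bit ([source_0_iff]).

    Level [k] of the tower is built against the operator of level [k+1], for every [k] at
    once; this regress is resolved by handing the index of the enumeration program to the
    program itself ([self_enumerating]).  The questions refer to jumps which are computed
    from the tower, while the tower depends on the questions; this circle is resolved by
    letting the construction depend on an arbitrary index [q] of a semidecision procedure
    and choosing [q] last ([diagonal_index]). *)

(** * Pairing and characteristic functions *)

Definition pfst (x : nat) : nat := fst (Cantor.of_nat x).
Definition psnd (x : nat) : nat := snd (Cantor.of_nat x).

Lemma pfst_pair x y : pfst ⟨x, y⟩ = x.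
Proof. unfold pfst. now rewrite Cantor.cancel_of_to. Qed.

Lemma psnd_pair x y : psnd ⟨x, y⟩ = y.
Proof. unfold psnd. now rewrite Cantor.cancel_of_to. Qed.

Lemma pair_eta x : ⟨pfst x, psnd x⟩ = x.
Proof. unfold pfst, psnd. now rewrite <- surjective_pairing, Cantor.cancel_to_of. Qed.

Lemma pair_inj a b c d : ⟨a, b⟩ = ⟨c, d⟩ -> a = c /\ b = d.
Proof. intros H. apply Cantor.to_nat_inj in H. now inversion H. Qed.

Lemma pair_ge x y : x + y <= ⟨x, y⟩.
Proof. pose proof (Cantor.to_nat_non_decreasing x y). lia. Qed.

Lemma psnd_le x : psnd x <= x.
Proof. rewrite <- (pair_eta x) at 2. pose proof (pair_ge (pfst x) (psnd x)). lia. Qed.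

Hint Rewrite pfst_pair psnd_pair pair_eta : pairs.
Global Opaque Cantor.to_nat Cantor.of_nat.

Definition chi (X : nset) (x : nat) : nat :=
  if excluded_middle_informative (X x) then 1 else 0.

Lemma chi_true (X : nset) x : X x -> chi X x = 1.
Proof. unfold chi. destruct (excluded_middle_informative (X x)); tauto. Qed.

Lemma chi_false (X : nset) x : ~ X x -> chi X x = 0.
Proof. unfold chi. destruct (excluded_middle_informative (X x)); tauto. Qed.

Lemma chi_eq1 (X : nset) x : chi X x = 1 <-> X x.
Proof.
  unfold chi. destruct (excluded_middle_informative (X x)); split; auto; easy.
Qed.

Lemma chi_iff (X Y : nset) x y : (X x <-> Y y) -> chi X x = chi Y y.
Proof.
  intros H. unfold chi.
  destruct (excluded_middle_informative (X x)), (excluded_middle_informative (Y y));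
    tauto.
Qed.

(** * Uniformly computable functionals *)

(** One program serves all pairs of an oracle and an input in [D].  A reduction that only
    works between particular sets is expressed by a [D] that fixes the oracle, with an
    [F] that need not mention it. *)
Definition computable_on (D : nset -> nat -> Prop) (F : nset -> nat -> nat) : Prop :=
  exists c, forall X x, D X x -> eval X c x (F X x).

Definition everywhere : nset -> nat -> Prop := fun _ _ => True.

(** The domain for functionals with an additional argument: in [⟨x, n⟩] only [x] is
    subject to [D]. *)
Definition lift (D : nset -> nat -> Prop) : nset -> nat -> Prop :=
  fun X y => D X (pfst y).

Lemma computable_weaken (D D' : nset -> nat -> Prop) F :
  computable_on D F -> (forall X x, D' X x -> D X x) -> computable_on D' F.
Proof. intros [c H] HD. exists c. auto. Qed.

Section Closure.
Variable D : nset -> nat -> Prop.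

Lemma computable_ext F G :
  computable_on D G -> (forall X x, D X x -> F X x = G X x) -> computable_on D F.
Proof. intros [c H] E. exists c. intros X x Hx. rewrite E by assumption. auto. Qed.

Lemma computable_id : computable_on D (fun _ x => x).
Proof.
  exists (Pair Fst Snd). intros X x _. cbn [eval].
  exists (pfst x), (psnd x). repeat split. symmetry; apply pair_eta.
Qed.

Lemma computable_comp (D' : nset -> nat -> Prop) F G :
  computable_on D' G -> computable_on D F -> (forall X x, D X x -> D' X (F X x)) ->
  computable_on D (fun X x => G X (F X x)).
Proof.
  intros [c Hc] [d Hd] H. exists (Comp c d). intros X x Hx. cbn [eval].
  exists (F X x). auto.
Qed.

Lemma computable_pair F G :
  computable_on D F -> computable_on D G -> computable_on D (fun X x => ⟨F X x, G X x⟩).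
Proof.
  intros [c Hc] [d Hd]. exists (Pair c d). intros X x Hx. cbn [eval].
  exists (F X x), (G X x). auto.
Qed.

Lemma computable_pfst F : computable_on D F -> computable_on D (fun X x => pfst (F X x)).
Proof.
  intros [c Hc]. exists (Comp Fst c). intros X x Hx. cbn [eval]. exists (F X x). auto.
Qed.

Lemma computable_psnd F : computable_on D F -> computable_on D (fun X x => psnd (F X x)).
Proof.
  intros [c Hc]. exists (Comp Snd c). intros X x Hx. cbn [eval]. exists (F X x). auto.
Qed.

Lemma computable_S F : computable_on D F -> computable_on D (fun X x => S (F X x)).
Proof.
  intros [c Hc]. exists (Comp Succ c). intros X x Hx. cbn [eval]. exists (F X x). auto.
Qed.

Lemma computable_const n : computable_on D (fun _ _ => n).
Proof.
  induction n as [|n IH].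
  - now exists Zero.
  - now apply computable_S.
Qed.

Lemma computable_oracle F : computable_on D F -> computable_on D (fun X x => chi X (F X x)).
Proof.
  intros [c Hc]. exists (Comp Oracle c). intros X x Hx. cbn [eval].
  exists (F X x). split; [auto|]. unfold chi.
  destruct (excluded_middle_informative (X (F X x))); auto.
Qed.

(** The step is only asked for at the true values of [f], so that it may contain
    an unbounded search which terminates for these values alone. *)
Lemma computable_rec (f : nset -> nat -> nat -> nat) N :
  computable_on D (fun X x => f X x 0) ->
  computable_on (fun X y => D X (pfst y) /\ psnd (psnd y) = f X (pfst y) (pfst (psnd y)))
    (fun X y => f X (pfst y) (S (pfst (psnd y)))) ->
  computable_on D N ->
  computable_on D (fun X x => f X x (N X x)).
Proof.
  intros [c Hc] [d Hd] [n Hn].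
  exists (Comp (Prec c d) (Pair (Pair Fst Snd) n)). intros X x Hx. cbn [eval].
  exists ⟨x, N X x⟩. split.
  - exists x, (N X x). repeat split; auto.
    exists (pfst x), (psnd x). repeat split. symmetry; apply pair_eta.
  - fold (pfst ⟨x, N X x⟩) (psnd ⟨x, N X x⟩). rewrite pfst_pair, psnd_pair.
    induction (N X x) as [|k IH]; cbn [prec_graph]; [auto|].
    exists (f X x k). split; [exact IH|].
    specialize (Hd X ⟨x, ⟨k, f X x k⟩⟩). autorewrite with pairs in Hd. auto.
Qed.

Lemma computable_primrec (f : nset -> nat -> nat -> nat)
    (G : nset -> nat -> nat -> nat -> nat) N :
  (forall X x n, f X x (S n) = G X x n (f X x n)) ->
  computable_on D (fun X x => f X x 0) ->
  computable_on (lift D) (fun X y => G X (pfst y) (pfst (psnd y)) (psnd (psnd y))) ->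
  computable_on D N ->
  computable_on D (fun X x => f X x (N X x)).
Proof.
  intros E H0 HS HN. apply computable_rec; auto.
  destruct HS as [c Hc]. exists c. intros X y [Hy Ey].
  rewrite E, <- Ey. apply Hc. exact Hy.
Qed.
End Closure.

Lemma computable_apply2 (D E : nset -> nat -> Prop) (F : nset -> nat -> nat -> nat) a b :
  computable_on (lift D) (fun X y => F X (pfst y) (psnd y)) ->
  computable_on E a -> computable_on E b -> (forall X x, E X x -> D X (a X x)) ->
  computable_on E (fun X x => F X (a X x) (b X x)).
Proof.
  intros HF Ha Hb H.
  eapply computable_ext.
  - refine (computable_comp _ _ (fun X x => ⟨a X x, b X x⟩) _ HF _ _).
    + now apply computable_pair.
    + intros X x Hx. unfold lift. rewrite pfst_pair. auto.
  - intros X x _. cbv beta. now rewrite pfst_pair, psnd_pair.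
Qed.

(** [effective] proves computability goals by recursion on the expression.
    [effective_rules] is redefined as closure rules become available, and [effective_hyp]
    uses computability hypotheses about functionals applied to arguments. *)
Ltac effective_rules := fail.
Ltac effective_hyp :=
  match goal with
  | H : computable_on ?D ?F |- computable_on ?E (fun X x => ?F X (@?a X x)) =>
      apply (computable_comp E D a F H)
  | H : computable_on ?D (fun X x => Nat.b2n (?F X x))
    |- computable_on ?E (fun X x => Nat.b2n (?F X (@?a X x))) =>
      apply (computable_comp E D a (fun X x => Nat.b2n (F X x)) H)
  | H : computable_on (lift ?D) (fun X x => ?F X (pfst x) (psnd x))
    |- computable_on ?E (fun X x => ?F X (@?a X x) (@?b X x)) =>
      apply (computable_apply2 D E F a b H)
  | H : computable_on (lift ?D) (fun X x => Nat.b2n (?F X (pfst x) (psnd x)))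
    |- computable_on ?E (fun X x => Nat.b2n (?F X (@?a X x) (@?b X x))) =>
      apply (computable_apply2 D E (fun X x y => Nat.b2n (F X x y)) a b H)
  end.
Ltac effective_step :=
  lazymatch goal with
  | |- computable_on _ (fun _ x => x) => apply computable_id
  | |- computable_on _ (fun _ _ => ?n) => apply computable_const
  | |- computable_on _ (fun X x => pfst (@?f X x)) => apply computable_pfst
  | |- computable_on _ (fun X x => psnd (@?f X x)) => apply computable_psnd
  | |- computable_on _ (fun X x => S (@?f X x)) => apply computable_S
  | |- computable_on _ (fun X x => Cantor.to_nat (@?f X x, @?g X x)) => apply computable_pair
  | |- computable_on _ (fun X x => chi X (@?f X x)) => apply computable_oracle
  | _ => first [effective_rules | effective_hyp]
  end.
Ltac effective := cbv beta;
  try lazymatch goal with |- forall _ _ _, _ = _ => intros; reflexivity end;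
  repeat first [assumption | progress cbv beta | effective_step
    | solve [unfold everywhere, lift in *; intros; autorewrite with pairs; intuition auto]].

Lemma computable_add D F G : computable_on D F -> computable_on D G ->
  computable_on D (fun X x => F X x + G X x).
Proof.
  intros HF HG.
  eapply computable_ext.
  - refine (computable_primrec D (fun X x n => n + F X x) (fun _ _ _ r => S r) G _ _ _ _);
      effective.
  - intros; apply Nat.add_comm.
Qed.

(** Branching is a primitive recursion from the constant 0, so a branch is evaluated only
    when its test has succeeded and may diverge otherwise.  Both branches are treated this
    way and the results are added. *)
Lemma computable_if_lazy D (t : nset -> nat -> bool) F G :
  computable_on D (fun X x => Nat.b2n (t X x)) ->
  computable_on (fun X x => D X x /\ t X x = true) F ->
  computable_on (fun X x => D X x /\ t X x = false) G ->
  computable_on D (fun X x => if t X x then F X x else G X x).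
Proof.
  intros Ht HF HG.
  assert (W : forall (t : nset -> nat -> bool) H,
    computable_on D (fun X x => Nat.b2n (t X x)) ->
    computable_on (fun X x => D X x /\ t X x = true) H ->
    computable_on D (fun X x => if t X x then H X x else 0)).
  { intros u H [c Hc] [d Hd].
    exists (Comp (Prec Zero (Comp d Fst)) (Pair (Pair Fst Snd) c)).
    intros X x Hx. cbn [eval]. exists ⟨x, Nat.b2n (u X x)⟩. split.
    - exists x, (Nat.b2n (u X x)). repeat split; auto.
      exists (pfst x), (psnd x). repeat split. symmetry; apply pair_eta.
    - fold (pfst ⟨x, Nat.b2n (u X x)⟩) (psnd ⟨x, Nat.b2n (u X x)⟩).
      rewrite pfst_pair, psnd_pair.
      destruct (u X x) eqn:E; cbn [Nat.b2n prec_graph]; [|reflexivity].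
      exists 0. split; [reflexivity|]. exists x. split; [|auto].
      fold (pfst ⟨x, ⟨0, 0⟩⟩). now rewrite pfst_pair. }
  assert (Hn : computable_on D (fun X x => Nat.b2n (negb (t X x)))).
  { eapply computable_ext.
    - refine (computable_primrec D (fun _ _ n => match n with 0 => 1 | _ => 0 end)
        (fun _ _ _ _ => 0) (fun X x => Nat.b2n (t X x)) _ _ _ _); effective.
    - intros X x _. cbv beta. now destruct (t X x). }
  apply computable_ext with
    (G := fun X x => (if t X x then F X x else 0) + (if negb (t X x) then G X x else 0)).
  - apply computable_add; apply W; auto.
    apply computable_weaken with (1 := HG). intros X x [? E]. split; auto.
    now destruct (t X x).
  - intros X x _. destruct (t X x); cbn; lia.
Qed.

Lemma computable_if D (t : nset -> nat -> bool) F G :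
  computable_on D (fun X x => Nat.b2n (t X x)) ->
  computable_on D F -> computable_on D G ->
  computable_on D (fun X x => if t X x then F X x else G X x).
Proof.
  intros Ht HF HG. apply computable_if_lazy; auto.
  - apply computable_weaken with (1 := HF). tauto.
  - apply computable_weaken with (1 := HG). tauto.
Qed.

Lemma computable_pred D F : computable_on D F -> computable_on D (fun X x => pred (F X x)).
Proof.
  intros HF.
  refine (computable_primrec D (fun _ _ n => pred n) (fun _ _ n _ => n) F _ _ _ _); effective.
Qed.

Lemma computable_sub D F G : computable_on D F -> computable_on D G ->
  computable_on D (fun X x => F X x - G X x).
Proof.
  intros HF HG.
  refine (computable_primrec D (fun X x n => F X x - n) (fun _ _ _ r => pred r) G _ _ _ _);
    effective.
  - intros; lia.
  - apply computable_ext with (1 := HF). intros; lia.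
  - apply computable_pred. effective.
Qed.

Lemma computable_mul D F G : computable_on D F -> computable_on D G ->
  computable_on D (fun X x => F X x * G X x).
Proof.
  intros HF HG.
  eapply computable_ext.
  - refine (computable_primrec D (fun X x n => n * F X x) (fun X x _ r => F X x + r) G _ _ _ _);
      effective.
    + exact (computable_const D 0).
    + apply computable_add; effective.
  - intros; apply Nat.mul_comm.
Qed.

Lemma computable_eq0 D F : computable_on D F ->
  computable_on D (fun X x => Nat.b2n (F X x =? 0)).
Proof.
  intros HF. eapply computable_ext.
  - refine (computable_primrec D (fun _ _ n => match n with 0 => 1 | _ => 0 end)
      (fun _ _ _ _ => 0) F _ _ _ _); effective.
  - intros X x _. cbv beta. now destruct (F X x).
Qed.

Ltac effective_rules ::=
  lazymatch goal with
  | |- computable_on _ (fun X x => @?f X x + @?g X x) => apply computable_add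
  | |- computable_on _ (fun X x => @?f X x - @?g X x) => apply computable_sub
  | |- computable_on _ (fun X x => pred (@?f X x)) => apply computable_pred
  | |- computable_on _ (fun X x => Nat.b2n (@?f X x =? 0)) => apply computable_eq0
  | |- computable_on _ (fun X x => if @?t X x then @?f X x else @?g X x) => apply computable_if
  end.

Lemma computable_leb D F G : computable_on D F -> computable_on D G ->
  computable_on D (fun X x => Nat.b2n (F X x <=? G X x)).
Proof.
  intros HF HG.
  apply computable_ext with (G := fun X x => Nat.b2n (F X x - G X x =? 0)); [effective|].
  intros X x _. f_equal. apply eq_iff_eq_true.
  rewrite Nat.leb_le, Nat.eqb_eq. lia.
Qed.

Lemma computable_ltb D F G : computable_on D F -> computable_on D G ->
  computable_on D (fun X x => Nat.b2n (F X x <? G X x)).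
Proof.
  intros HF HG.
  apply (computable_leb D (fun X x => S (F X x))); effective.
Qed.

Lemma computable_eqb D F G : computable_on D F -> computable_on D G ->
  computable_on D (fun X x => Nat.b2n (F X x =? G X x)).
Proof.
  intros HF HG.
  apply computable_ext with
    (G := fun X x => Nat.b2n ((F X x - G X x) + (G X x - F X x) =? 0)); [effective|].
  intros X x _. f_equal. apply eq_iff_eq_true.
  rewrite !Nat.eqb_eq. lia.
Qed.

Lemma computable_andb D (t u : nset -> nat -> bool) :
  computable_on D (fun X x => Nat.b2n (t X x)) ->
  computable_on D (fun X x => Nat.b2n (u X x)) ->
  computable_on D (fun X x => Nat.b2n (t X x && u X x)).
Proof.
  intros HF HG.
  apply computable_ext with (G := fun X x => if t X x then Nat.b2n (u X x) else 0); [effective|].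
  intros X x _. now destruct (t X x).
Qed.

Lemma computable_orb D (t u : nset -> nat -> bool) :
  computable_on D (fun X x => Nat.b2n (t X x)) ->
  computable_on D (fun X x => Nat.b2n (u X x)) ->
  computable_on D (fun X x => Nat.b2n (t X x || u X x)).
Proof.
  intros HF HG.
  apply computable_ext with (G := fun X x => if t X x then 1 else Nat.b2n (u X x)); [effective|].
  intros X x _. now destruct (t X x).
Qed.

Lemma computable_negb D (t : nset -> nat -> bool) :
  computable_on D (fun X x => Nat.b2n (t X x)) ->
  computable_on D (fun X x => Nat.b2n (negb (t X x))).
Proof.
  intros HF.
  apply computable_ext with (G := fun X x => if t X x then 0 else 1); [effective|].
  intros X x _. now destruct (t X x).
Qed.

Lemma computable_ifb D (t u v : nset -> nat -> bool) :
  computable_on D (fun X x => Nat.b2n (t X x)) ->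
  computable_on D (fun X x => Nat.b2n (u X x)) ->
  computable_on D (fun X x => Nat.b2n (v X x)) ->
  computable_on D (fun X x => Nat.b2n (if t X x then u X x else v X x)).
Proof.
  intros Ht HF HG.
  apply computable_ext with
    (G := fun X x => if t X x then Nat.b2n (u X x) else Nat.b2n (v X x)); [effective|].
  intros X x _. now destruct (t X x).
Qed.

Ltac division_rules := fail.
Ltac effective_rules ::=
  lazymatch goal with
  | |- computable_on _ (fun X x => @?f X x + @?g X x) => apply computable_add
  | |- computable_on _ (fun X x => @?f X x - @?g X x) => apply computable_sub
  | |- computable_on _ (fun X x => @?f X x * @?g X x) => apply computable_mul
  | |- computable_on _ (fun X x => pred (@?f X x)) => apply computable_pred
  | |- computable_on _ (fun X x => if @?t X x then @?f X x else @?g X x) => apply computable_if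
  | |- computable_on _ (fun X x => Nat.b2n (@?f X x =? @?g X x)) => apply computable_eqb
  | |- computable_on _ (fun X x => Nat.b2n (@?f X x <=? @?g X x)) => apply computable_leb
  | |- computable_on _ (fun X x => Nat.b2n (@?f X x <? @?g X x)) => apply computable_ltb
  | |- computable_on _ (fun X x => Nat.b2n (@?f X x && @?g X x)) => apply computable_andb
  | |- computable_on _ (fun X x => Nat.b2n (@?f X x || @?g X x)) => apply computable_orb
  | |- computable_on _ (fun X x => Nat.b2n (negb (@?f X x))) => apply computable_negb
  | |- computable_on _ (fun X x => Nat.b2n (if @?t X x then @?f X x else @?g X x)) =>
      apply computable_ifb
  | |- _ => division_rules
  end.

Lemma computable_iter D (F : nset -> nat -> nat -> nat) N Z :
  computable_on (lift D) (fun X y => F X (pfst y) (psnd y)) ->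
  computable_on D N -> computable_on D Z ->
  computable_on D (fun X x => Nat.iter (N X x) (F X x) (Z X x)).
Proof.
  intros HF HN HZ.
  refine (computable_primrec D (fun X x n => Nat.iter n (F X x) (Z X x))
    (fun X x _ r => F X x r) N _ _ _ _); effective.
Qed.

(** * Bounded and unbounded search *)

(** The value is [n] if the search fails. *)
Fixpoint least_below (t : nat -> bool) (n : nat) : nat :=
  match n with
  | 0 => 0
  | S k => if least_below t k <? k then least_below t k else if t k then k else S k
  end.

Lemma least_below_spec t n :
  (least_below t n < n /\ t (least_below t n) = true /\
     forall m, m < least_below t n -> t m = false) \/
  (least_below t n = n /\ forall m, m < n -> t m = false).
Proof.
  induction n as [|n IH]; cbn [least_below].
  - right. split; [reflexivity|]. lia.
  - destruct (Nat.ltb_spec (least_below t n) n) as [L|L].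
    + destruct IH as [IH|IH]; [|lia]. left. split; [lia|]. tauto.
    + assert (H : forall m, m < n -> t m = false).
      { destruct IH as [IH|IH]; [lia|]. tauto. }
      destruct (t n) eqn:E.
      * left. auto.
      * right. split; [reflexivity|]. intros m Hm.
        destruct (Nat.eq_dec m n) as [->|]; [assumption|]. apply H. lia.
Qed.

Lemma least_below_found t n m : m < n -> t m = true ->
  least_below t n <= m /\ t (least_below t n) = true.
Proof.
  intros L E. destruct (least_below_spec t n) as [(A & B & C)|[A B]].
  - split; [|assumption]. destruct (le_lt_dec (least_below t n) m); [assumption|].
    rewrite C in E; congruence.
  - rewrite B in E; congruence.
Qed.

Lemma least_below_eq t n w : w < n -> t w = true -> (forall m, m < w -> t m = false) ->
  least_below t n = w.
Proof.
  intros L E H. destruct (least_below_found t n w L E) as [M F].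
  destruct (le_lt_dec w (least_below t n)) as [|C]; [lia|]. rewrite H in F; congruence.
Qed.

Definition exists_below (t : nat -> bool) (n : nat) : bool := least_below t n <? n.

Lemma exists_below_true t n : exists_below t n = true <-> exists m, m < n /\ t m = true.
Proof.
  unfold exists_below. rewrite Nat.ltb_lt. split.
  - intros L. destruct (least_below_spec t n) as [(A & B & C)|[A B]]; [eauto|lia].
  - intros (m & L & E). destruct (least_below_found t n m L E). lia.
Qed.

(** Chosen classically, so that the value of a search can be named before it is known to
    terminate. *)
Definition mu (t : nat -> bool) : nat :=
  epsilon (inhabits 0) (fun n => t n = true /\ forall m, m < n -> t m = false).

Lemma mu_spec t : (exists n, t n = true) ->
  t (mu t) = true /\ forall m, m < mu t -> t m = false.
Proof.
  intros [n Hn].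
  apply (epsilon_spec (inhabits 0) (fun n => t n = true /\ forall m, m < n -> t m = false)).
  exists (least_below t (S n)). destruct (least_below_found t (S n) n) as [_ H]; [lia|assumption|].
  split; [assumption|]. destruct (least_below_spec t (S n)) as [?|[A B]]; [tauto|].
  intros m Hm. apply B. lia.
Qed.

Lemma computable_least_below D (t : nset -> nat -> nat -> bool) N :
  computable_on (lift D) (fun X y => Nat.b2n (t X (pfst y) (psnd y))) ->
  computable_on D N ->
  computable_on D (fun X x => least_below (t X x) (N X x)).
Proof.
  intros Ht HN.
  refine (computable_primrec D (fun X x n => least_below (t X x) n)
    (fun X x n r => if r <? n then r else if t X x n then n else S n) N _ _ _ _); effective.
  exact (computable_const D 0).
Qed.

Lemma computable_exists_below D (t : nset -> nat -> nat -> bool) N :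
  computable_on (lift D) (fun X y => Nat.b2n (t X (pfst y) (psnd y))) ->
  computable_on D N ->
  computable_on D (fun X x => Nat.b2n (exists_below (t X x) (N X x))).
Proof.
  intros Ht HN. apply computable_ltb; [now apply computable_least_below|assumption].
Qed.

Lemma search_code D (t : nset -> nat -> nat -> bool) :
  computable_on (lift D) (fun X y => Nat.b2n (t X (pfst y) (psnd y))) ->
  exists c, forall X x, D X x -> forall n,
    eval X c x n <-> (t X x n = true /\ forall m, m < n -> t X x m = false).
Proof.
  intros Ht. apply computable_negb in Ht. destruct Ht as [c Hc].
  exists (Mu c). intros X x Hx n. cbn [eval].
  assert (H : forall m, eval X c ⟨x, m⟩ (Nat.b2n (negb (t X x m)))).
  { intros m. specialize (Hc X ⟨x, m⟩). unfold lift in Hc.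
    rewrite pfst_pair, psnd_pair in Hc. auto. }
  split.
  - intros [A B]. split.
    + pose proof (eval_fun _ _ _ _ _ A (H n)) as E. now destruct (t X x n).
    + intros m Hm. destruct (B m Hm) as [v Hv].
      pose proof (eval_fun _ _ _ _ _ Hv (H m)) as E. now destruct (t X x m).
  - intros [A B]. split.
    + specialize (H n). now rewrite A in H.
    + intros m Hm. exists 0. specialize (H m). now rewrite (B m Hm) in H.
Qed.

Lemma computable_mu D (t : nset -> nat -> nat -> bool) :
  computable_on (lift D) (fun X y => Nat.b2n (t X (pfst y) (psnd y))) ->
  (forall X x, D X x -> exists n, t X x n = true) ->
  computable_on D (fun X x => mu (t X x)).
Proof.
  intros Ht H. destruct (search_code D t Ht) as [c Hc]. exists c.
  intros X x Hx. apply Hc; [assumption|]. apply mu_spec. auto.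
Qed.

Lemma semidecidable D (t : nset -> nat -> nat -> bool) :
  computable_on (lift D) (fun X y => Nat.b2n (t X (pfst y) (psnd y))) ->
  exists c, forall X x, D X x ->
    ((exists y, eval X c x y) <-> exists w, t X x w = true).
Proof.
  intros Ht. destruct (search_code D t Ht) as [c Hc]. exists c.
  intros X x Hx. split.
  - intros [y Hy]. apply Hc in Hy; [|assumption]. exists y; tauto.
  - intros Hw. exists (mu (t X x)). apply Hc; [assumption|]. now apply mu_spec.
Qed.

Lemma computable_div4 D F : computable_on D F -> computable_on D (fun X x => F X x / 4).
Proof.
  intros HF. apply (computable_comp _ (fun _ _ => True) F (fun _ n => n / 4)); auto.
  eapply computable_ext.
  - refine (computable_least_below (fun _ _ => True) (fun _ n q => n <? 4 * S q) (fun _ n => S n) _ _);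
      effective.
  - intros X n _. cbv beta.
    pose proof (Nat.div_mod_eq n 4) as E. pose proof (Nat.mod_upper_bound n 4) as B.
    destruct (least_below_spec (fun q => n <? 4 * S q) (S n)) as [(H1 & H2 & H3)|[H1 H2]].
    + apply Nat.ltb_lt in H2.
      destruct (Nat.lt_trichotomy (n / 4) (least_below (fun q => n <? 4 * S q) (S n)))
        as [L|[L|L]]; [|assumption|lia].
      apply H3 in L. apply Nat.ltb_ge in L. lia.
    + specialize (H2 n). rewrite Nat.ltb_ge in H2. lia.
Qed.

Lemma computable_mod4 D F : computable_on D F -> computable_on D (fun X x => F X x mod 4).
Proof.
  intros HF. apply computable_ext with (G := fun X x => F X x - 4 * (F X x / 4)).
  - effective. now apply computable_div4.
  - intros X x _. pose proof (Nat.div_mod_eq (F X x) 4). lia.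
Qed.
Ltac division_rules ::=
  lazymatch goal with
  | |- computable_on _ (fun X x => @?f X x / 4) => apply computable_div4
  | |- computable_on _ (fun X x => @?f X x mod 4) => apply computable_mod4
  end.

(** * A universal machine *)

(** A stack machine whose states and stacks are numbers: [eval_state e x K] is about to
    apply the program with index [e] to [x] and to pass the value to the stack [K];
    [return_state v K] passes [v] to [K].  A machine, unlike an evaluator defined by
    recursion, is the iteration of a function given by cases. *)
Definition eval_state (e x K : nat) : nat := ⟨0, ⟨⟨e, x⟩, K⟩⟩.
Definition return_state (v K : nat) : nat := ⟨1, ⟨v, K⟩⟩.
Definition push_frame (tag d K : nat) : nat := S ⟨⟨tag, d⟩, K⟩.

(** Queries to numbers [>= w] block the machine in the state [⟨2, 0⟩].  Hence a computation
    that succeeds for [w] uses the oracle below [w] only. *)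
Definition step_eval (orc : nat -> nat) (w e x K : nat) : nat :=
  if e =? 0 then (if x <? w then return_state (orc x) K else ⟨2, 0⟩)
  else if e =? 1 then return_state 0 K
  else if e =? 2 then return_state (S x) K
  else if e =? 3 then return_state (pfst x) K
  else if e =? 4 then return_state (psnd x) K
  else let q := (e - 5) / 4 in let r := (e - 5) mod 4 in
  if r =? 0 then eval_state (pfst q) x (push_frame 0 ⟨psnd q, x⟩ K)
  else if r =? 1 then eval_state (psnd q) x (push_frame 2 (pfst q) K)
  else if r =? 2 then
    (if psnd x =? 0 then eval_state (pfst q) (pfst x) K
     else eval_state e ⟨pfst x, pred (psnd x)⟩
            (push_frame 3 ⟨psnd q, ⟨pfst x, pred (psnd x)⟩⟩ K))
  else eval_state q ⟨x, 0⟩ (push_frame 4 ⟨q, ⟨x, 0⟩⟩ K).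

(** Frames 0 and 1 wait for the halves of a pair, 2 for the inner value of a composition,
    3 for the previous value of a recursion and 4 for a test of a minimization. *)
Definition step_return (v tag d K : nat) : nat :=
  if tag =? 0 then eval_state (pfst d) (psnd d) (push_frame 1 v K)
  else if tag =? 1 then return_state ⟨d, v⟩ K
  else if tag =? 2 then eval_state d v K
  else if tag =? 3 then eval_state (pfst d) ⟨pfst (psnd d), ⟨psnd (psnd d), v⟩⟩ K
  else if v =? 0 then return_state (psnd (psnd d)) K
  else eval_state (pfst d) ⟨pfst (psnd d), S (psnd (psnd d))⟩
         (push_frame 4 ⟨pfst d, ⟨pfst (psnd d), S (psnd (psnd d))⟩⟩ K).

Definition step (orc : nat -> nat) (w s : nat) : nat :=
  if pfst s =? 0 then step_eval orc w (pfst (pfst (psnd s))) (psnd (pfst (psnd s))) (psnd (psnd s))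
  else if pfst s =? 1 then
    (if psnd (psnd s) =? 0 then s
     else step_return (pfst (psnd s)) (pfst (pfst (pred (psnd (psnd s)))))
            (psnd (pfst (pred (psnd (psnd s)))))
            (psnd (pred (psnd (psnd s)))))
  else s.

(** The bound [w] limits both the steps and the queries, so it is an upper bound for the
    use of the computation.  The value is [S y] for a computation with output [y] and [0]
    for an unfinished one. *)
Definition run (orc : nat -> nat) (w e x : nat) : nat :=
  let s := Nat.iter w (step orc w) (eval_state e x 0) in
  if (pfst s =? 1) && (psnd (psnd s) =? 0) then S (pfst (psnd s)) else 0.

Lemma computable_step D (orc : nset -> nat -> nat -> nat) w s :
  computable_on (lift D) (fun X y => orc X (pfst y) (psnd y)) ->
  computable_on D w -> computable_on D s ->
  computable_on D (fun X x => step (orc X x) (w X x) (s X x)).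
Proof.
  intros Ho Hw Hs.
  assert (H : forall a, computable_on D a -> computable_on D (fun X x => orc X x (a X x))).
  { intros a Ha. apply (computable_apply2 D D orc (fun _ x => x) a); auto. effective. }
  unfold step, step_eval, step_return, eval_state, return_state, push_frame. effective.
Qed.

Lemma computable_run D (orc : nset -> nat -> nat -> nat) w e v :
  computable_on (lift D) (fun X y => orc X (pfst y) (psnd y)) ->
  computable_on D w -> computable_on D e -> computable_on D v ->
  computable_on D (fun X x => run (orc X x) (w X x) (e X x) (v X x)).
Proof.
  intros Ho Hw He Hv.
  assert (H : computable_on D (fun X x =>
     Nat.iter (w X x) (step (orc X x) (w X x)) (eval_state (e X x) (v X x) 0))).
  { apply (computable_iter D (fun X x s => step (orc X x) (w X x) s)); auto.
    - apply (computable_step _ (fun X y => orc X (pfst y)) (fun X y => w X (pfst y))); effective.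
    - unfold eval_state. effective. }
  unfold run. effective.
Qed.

Lemma step_agree orc orc' w s : (forall x, x < w -> orc x = orc' x) ->
  step orc w s = step orc' w s.
Proof.
  intros H. unfold step, step_eval. destruct (pfst s =? 0); [|reflexivity].
  destruct (Nat.ltb_spec (psnd (pfst (psnd s))) w); [|reflexivity].
  now rewrite H.
Qed.

(** The use principle: a query that could tell the oracles apart blocks the machine. *)
Lemma run_agree orc orc' w e x : (forall x, x < w -> orc x = orc' x) ->
  run orc w e x = run orc' w e x.
Proof.
  intros H. unfold run.
  assert (E : forall n s, Nat.iter n (step orc w) s = Nat.iter n (step orc' w) s).
  { intros n s. induction n as [|n IH]; [reflexivity|rewrite !Nat.iter_succ].
    rewrite IH. now apply step_agree. }
  now rewrite E.
Qed.

Section Machine.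
Variable Y : nset.

Section Steps.
Variable w : nat.
Notation stp := (step (chi Y) w).

Definition goes (N s t : nat) : Prop := exists n, n <= N /\ Nat.iter n stp s = t.

Lemma goes_trans M N s t u : goes M s t -> goes N t u -> goes (M + N) s u.
Proof.
  intros (m & Hm & <-) (n & Hn & <-). exists (n + m). split; [lia|].
  apply Nat.iter_add.
Qed.

Lemma goes_step N s t : goes N (stp s) t -> goes (S N) s t.
Proof.
  intros (n & Hn & <-). exists (S n). split; [lia|]. apply Nat.iter_succ_r.
Qed.

Lemma goes_here N s : goes N s s.
Proof. exists 0. split; [lia|reflexivity]. Qed.

Lemma step_at_eval e x K : stp (eval_state e x K) = step_eval (chi Y) w e x K.
Proof. unfold step, eval_state. now autorewrite with pairs. Qed.

Lemma step_at_return v tag d K : stp (return_state v (push_frame tag d K)) = step_return v tag d K.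
Proof.
  unfold step, return_state, push_frame. autorewrite with pairs. cbn.
  now autorewrite with pairs.
Qed.

Lemma step_compound q r x K : r < 4 ->
  stp (eval_state (5 + r + 4 * q) x K) =
  (if r =? 0 then eval_state (pfst q) x (push_frame 0 ⟨psnd q, x⟩ K)
  else if r =? 1 then eval_state (psnd q) x (push_frame 2 (pfst q) K)
  else if r =? 2 then
    (if psnd x =? 0 then eval_state (pfst q) (pfst x) K
     else eval_state (5 + r + 4 * q) ⟨pfst x, pred (psnd x)⟩
            (push_frame 3 ⟨psnd q, ⟨pfst x, pred (psnd x)⟩⟩ K))
  else eval_state q ⟨x, 0⟩ (push_frame 4 ⟨q, ⟨x, 0⟩⟩ K)).
Proof.
  intros Hr. rewrite step_at_eval. unfold step_eval.
  replace (5 + r + 4 * q - 5) with (r + q * 4) by lia.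
  rewrite Nat.div_add, Nat.Div0.mod_add, (Nat.div_small r 4), (Nat.mod_small r 4) by lia.
  reflexivity.
Qed.

Lemma step_Pair f g x K : stp (eval_state (encode (Pair f g)) x K) =
  eval_state (encode f) x (push_frame 0 ⟨encode g, x⟩ K).
Proof.
  cbn [encode]. rewrite (step_compound _ 0) by lia. cbn. now autorewrite with pairs.
Qed.

Lemma step_Comp f g x K : stp (eval_state (encode (Comp f g)) x K) =
  eval_state (encode g) x (push_frame 2 (encode f) K).
Proof.
  cbn [encode]. rewrite (step_compound _ 1) by lia. cbn. now autorewrite with pairs.
Qed.

Lemma step_Prec f g x K : stp (eval_state (encode (Prec f g)) x K) =
  if psnd x =? 0 then eval_state (encode f) (pfst x) K
  else eval_state (encode (Prec f g)) ⟨pfst x, pred (psnd x)⟩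
         (push_frame 3 ⟨encode g, ⟨pfst x, pred (psnd x)⟩⟩ K).
Proof.
  cbn [encode]. rewrite (step_compound _ 2) by lia.
  cbn [Nat.eqb]. now autorewrite with pairs.
Qed.

Lemma step_Mu f x K : stp (eval_state (encode (Mu f)) x K) =
  eval_state (encode f) ⟨x, 0⟩ (push_frame 4 ⟨encode f, ⟨x, 0⟩⟩ K).
Proof. cbn [encode]. now rewrite (step_compound _ 3) by lia. Qed.

Lemma step_return0 v g x K :
  stp (return_state v (push_frame 0 ⟨g, x⟩ K)) = eval_state g x (push_frame 1 v K).
Proof. rewrite step_at_return. unfold step_return. cbn. now autorewrite with pairs. Qed.

Lemma step_return1 v u K : stp (return_state v (push_frame 1 u K)) = return_state ⟨u, v⟩ K.
Proof. now rewrite step_at_return. Qed.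

Lemma step_return2 v f K : stp (return_state v (push_frame 2 f K)) = eval_state f v K.
Proof. now rewrite step_at_return. Qed.

Lemma step_return3 v g a n K :
  stp (return_state v (push_frame 3 ⟨g, ⟨a, n⟩⟩ K)) = eval_state g ⟨a, ⟨n, v⟩⟩ K.
Proof. rewrite step_at_return. unfold step_return. cbn. now autorewrite with pairs. Qed.

Lemma step_return4 v f x i K : stp (return_state v (push_frame 4 ⟨f, ⟨x, i⟩⟩ K)) =
  if v =? 0 then return_state i K
  else eval_state f ⟨x, S i⟩ (push_frame 4 ⟨f, ⟨x, S i⟩⟩ K).
Proof. rewrite step_at_return. unfold step_return. cbn. now autorewrite with pairs. Qed.

Lemma step_halted v : stp (return_state v 0) = return_state v 0.
Proof. unfold step, return_state. now autorewrite with pairs. Qed.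

Lemma step_stuck : stp ⟨2, 0⟩ = ⟨2, 0⟩.
Proof. unfold step. now autorewrite with pairs. Qed.

Lemma iter_fixed n s : stp s = s -> Nat.iter n stp s = s.
Proof. intros E. induction n as [|n IH]; [reflexivity|]. now rewrite Nat.iter_succ, IH. Qed.

End Steps.

(** The number of steps is bounded independently of [w] and of the stack, which makes the
    bounds for the parts of a program add up. *)
Lemma eval_run c x y : eval Y c x y ->
  exists N, forall w, N <= w -> forall K, goes w N (eval_state (encode c) x K) (return_state y K).
Proof.
  revert x y. induction c as [| | | | |f IHf g IHg|f IHf g IHg|f IHf g IHg|f IHf];
    intros x y Hy.
  - exists (S x). intros w Hw K. apply goes_step. rewrite step_at_eval.
    unfold step_eval. cbn [encode Nat.eqb].
    destruct (Nat.ltb_spec x w); [|lia].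
    replace (chi Y x) with y; [apply goes_here|].
    destruct Hy as [[H1 ->]|[H1 ->]]; symmetry; [now apply chi_true|now apply chi_false].
  - exists 1. intros w Hw K. apply goes_step. rewrite step_at_eval. cbn in Hy. subst y.
    apply goes_here.
  - exists 1. intros w Hw K. apply goes_step. rewrite step_at_eval. cbn in Hy. subst y.
    apply goes_here.
  - exists 1. intros w Hw K. apply goes_step. rewrite step_at_eval. cbn in Hy. subst y.
    apply goes_here.
  - exists 1. intros w Hw K. apply goes_step. rewrite step_at_eval. cbn in Hy. subst y.
    apply goes_here.
  - destruct Hy as (u & v & Hu & Hv & ->).
    destruct (IHf _ _ Hu) as [M HM]. destruct (IHg _ _ Hv) as [N HN].
    exists (S (M + S (N + 1))). intros w Hw K. apply goes_step. rewrite step_Pair.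
    eapply goes_trans; [apply HM; lia|]. apply goes_step. rewrite step_return0.
    eapply goes_trans; [apply HN; lia|]. apply goes_step. rewrite step_return1.
    apply goes_here.
  - destruct Hy as (u & Hu & Hv).
    destruct (IHg _ _ Hu) as [M HM]. destruct (IHf _ _ Hv) as [N HN].
    exists (S (M + S N)). intros w Hw K. apply goes_step. rewrite step_Comp.
    eapply goes_trans; [apply HM; lia|]. apply goes_step. rewrite step_return2.
    apply HN; lia.
  - cbn [eval] in Hy. fold (pfst x) (psnd x) in Hy.
    rewrite <- (pair_eta x). revert Hy. generalize (pfst x), (psnd x). clear x.
    intros a n. revert y. induction n as [|n IHn]; cbn [prec_graph]; intros y Hy.
    + destruct (IHf _ _ Hy) as [M HM]. exists (S M). intros w Hw K.
      apply goes_step. rewrite step_Prec, pfst_pair, psnd_pair. apply HM; lia.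
    + destruct Hy as (r & Hr & Hy). destruct (IHn _ Hr) as [M HM].
      destruct (IHg _ _ Hy) as [N HN].
      exists (S (M + S N)). intros w Hw K. apply goes_step.
      rewrite step_Prec, pfst_pair, psnd_pair. cbn [Nat.eqb pred].
      eapply goes_trans; [apply HM; lia|]. apply goes_step. rewrite step_return3.
      apply HN; lia.
  - destruct Hy as [Hy Hlt].
    assert (H : forall d i, i + d = y -> exists N, forall w, N <= w -> forall K,
      goes w N (eval_state (encode f) ⟨x, i⟩ (push_frame 4 ⟨encode f, ⟨x, i⟩⟩ K))
        (return_state y K)).
    { intros d. induction d as [|d IHd]; intros i Hi.
      - replace i with y by lia. destruct (IHf _ _ Hy) as [M HM].
        exists (M + 1). intros w Hw K.
        eapply goes_trans; [apply HM; lia|]. apply goes_step. rewrite step_return4.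
        apply goes_here.
      - destruct (Hlt i) as [v Hv]; [lia|]. destruct (IHf _ _ Hv) as [M HM].
        destruct (IHd (S i)) as [N HN]; [lia|].
        exists (M + S N). intros w Hw K.
        eapply goes_trans; [apply HM; lia|]. apply goes_step. rewrite step_return4.
        apply HN; lia. }
    destruct (H y 0) as [N HN]; [lia|]. exists (S N). intros w Hw K.
    apply goes_step. rewrite step_Mu. apply HN; lia.
Qed.

Lemma run_complete c x y : eval Y c x y ->
  exists w, run (chi Y) w (encode c) x = S y.
Proof.
  intros Hy. destruct (eval_run _ _ _ Hy) as [N HN]. exists N.
  destruct (HN N (le_n N) 0) as (n & Hn & E).
  assert (H : Nat.iter N (step (chi Y) N) (eval_state (encode c) x 0) = return_state y 0).
  { transitivity (Nat.iter (N - n + n) (step (chi Y) N) (eval_state (encode c) x 0)).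
    - f_equal. lia.
    - rewrite Nat.iter_add, E. apply iter_fixed, step_halted. }
  unfold run. rewrite H. unfold return_state. now autorewrite with pairs.
Qed.

Section Sound.
Variable w : nat.
Notation stp := (step (chi Y) w).

Lemma eval_neq_return e x K v L : eval_state e x K <> return_state v L.
Proof. unfold eval_state, return_state. intros E. apply pair_inj in E. now destruct E. Qed.

(** Induction on the number of steps: a halting run has to return to the stack it started
    from. *)
Lemma halting_eval n : forall c x K v,
  Nat.iter n stp (eval_state (encode c) x K) = return_state v 0 ->
  exists y m, m < n /\ eval Y c x y /\ Nat.iter m stp (return_state y K) = return_state v 0.
Proof.
  induction n as [n IH] using lt_wf_ind. intros c x K v E.
  destruct n as [|n]; [now apply eval_neq_return in E|].
  rewrite Nat.iter_succ_r in E.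
  destruct c as [| | | | |f g|f g|f g|f].
  - rewrite step_at_eval in E. unfold step_eval in E. cbn [encode Nat.eqb] in E.
    destruct (x <? w).
    + exists (chi Y x), n. repeat split; [lia| |assumption].
      cbn [eval]. unfold chi. destruct (excluded_middle_informative (Y x)); auto.
    + rewrite iter_fixed in E by apply step_stuck.
      unfold return_state in E. apply pair_inj in E. now destruct E.
  - rewrite step_at_eval in E. exists 0, n. repeat split; [lia|assumption].
  - rewrite step_at_eval in E. exists (S x), n. repeat split; [lia|assumption].
  - rewrite step_at_eval in E. exists (pfst x), n. repeat split; [lia|assumption].
  - rewrite step_at_eval in E. exists (psnd x), n. repeat split; [lia|assumption].
  - rewrite step_Pair in E. apply IH in E; [|lia].
    destruct E as (u & m & Hm & Hu & E).
    destruct m as [|m].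
    { unfold return_state, push_frame in E. cbn in E. apply pair_inj in E. destruct E as [_ E].
      apply pair_inj in E. destruct E; lia. }
    rewrite Nat.iter_succ_r, step_return0 in E. apply IH in E; [|lia].
    destruct E as (u' & m' & Hm' & Hu' & E).
    destruct m' as [|m'].
    { unfold return_state, push_frame in E. cbn in E. apply pair_inj in E. destruct E as [_ E].
      apply pair_inj in E. destruct E; lia. }
    rewrite Nat.iter_succ_r, step_return1 in E.
    exists ⟨u, u'⟩, m'. repeat split; [lia| |assumption]. exists u, u'. auto.
  - rewrite step_Comp in E. apply IH in E; [|lia].
    destruct E as (u & m & Hm & Hu & E).
    destruct m as [|m].
    { unfold return_state, push_frame in E. cbn in E. apply pair_inj in E. destruct E as [_ E].
      apply pair_inj in E. destruct E; lia. }
    rewrite Nat.iter_succ_r, step_return2 in E. apply IH in E; [|lia].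
    destruct E as (u' & m' & Hm' & Hu' & E).
    exists u', m'. repeat split; [lia| |assumption]. exists u. auto.
  - rewrite step_Prec in E. cbn [eval]. fold (pfst x) (psnd x).
    destruct (psnd x) as [|k]; cbn [Nat.eqb pred] in E.
    + apply IH in E; [|lia]. destruct E as (u & m & Hm & Hu & E).
      exists u, m. repeat split; [lia|assumption..].
    + apply IH in E; [|lia]. destruct E as (u & m & Hm & Hu & E).
      cbn [eval] in Hu.
      fold (pfst ⟨pfst x, k⟩) (psnd ⟨pfst x, k⟩) in Hu. rewrite pfst_pair, psnd_pair in Hu.
      destruct m as [|m].
      { unfold return_state, push_frame in E. cbn in E. apply pair_inj in E. destruct E as [_ E].
        apply pair_inj in E. destruct E; lia. }
      rewrite Nat.iter_succ_r, step_return3 in E. apply IH in E; [|lia].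
      destruct E as (u' & m' & Hm' & Hu' & E).
      exists u', m'. repeat split; [lia| |assumption]. exists u. auto.
  - rewrite step_Mu in E.
    assert (H : forall m i, m <= n ->
      Nat.iter m stp (eval_state (encode f) ⟨x, i⟩ (push_frame 4 ⟨encode f, ⟨x, i⟩⟩ K)) =
        return_state v 0 ->
      exists y m', m' < m /\ i <= y /\ eval Y f ⟨x, y⟩ 0 /\
        (forall j, i <= j < y -> exists u, eval Y f ⟨x, j⟩ (S u)) /\
        Nat.iter m' stp (return_state y K) = return_state v 0).
    { intros m. induction m as [m IHm] using lt_wf_ind. intros i Hm E'.
      apply IH in E'; [|lia]. destruct E' as (u & m1 & Hm1 & Hu & E').
      destruct m1 as [|m1].
      { unfold return_state, push_frame in E'. cbn in E'. apply pair_inj in E'. destruct E' as [_ E'].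
        apply pair_inj in E'. destruct E'; lia. }
      rewrite Nat.iter_succ_r, step_return4 in E'.
      destruct u as [|u]; cbn [Nat.eqb] in E'.
      - exists i, m1. repeat split; [lia|lia|assumption| |assumption]. intros; lia.
      - apply IHm in E'; [|lia|lia].
        destruct E' as (y & m2 & H1 & H2 & H3 & H4 & H5).
        exists y, m2. repeat split; [lia|lia|assumption| |assumption].
        intros j Hj. destruct (Nat.eq_dec i j) as [<-|]; [eauto|]. apply H4. lia. }
    apply H in E; [|lia]. destruct E as (y & m & H1 & H2 & H3 & H4 & H5).
    exists y, m. repeat split; [lia|assumption| |assumption].
    intros i Hi. apply H4. lia.
Qed.

Lemma run_sound c x y : run (chi Y) w (encode c) x = S y -> eval Y c x y.
Proof.
  unfold run. set (s := Nat.iter w stp (eval_state (encode c) x 0)).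
  destruct (Nat.eqb_spec (pfst s) 1) as [E1|]; [|discriminate].
  destruct (Nat.eqb_spec (psnd (psnd s)) 0) as [E2|]; [|discriminate].
  cbn [andb]. intros [= Ey].
  assert (E : s = return_state y 0).
  { unfold return_state. rewrite <- (pair_eta s), <- (pair_eta (psnd s)). congruence. }
  apply halting_eval in E. destruct E as (z & m & _ & Hz & E).
  rewrite iter_fixed in E by apply step_halted. unfold return_state in E.
  apply pair_inj in E. destruct E as [_ E]. apply pair_inj in E.
  destruct E as [-> _]. assumption.
Qed.
End Sound.
End Machine.

Lemma run_Phi Y e x y : (exists w, run (chi Y) w e x = S y) <-> Phi e Y x y.
Proof.
  destruct (encode_surj e) as [c <-]. split.
  - intros [w Hw]. exists c. split; [reflexivity|]. now apply run_sound in Hw.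
  - intros (d & E & H). apply encode_inj in E. subst d. now apply run_complete.
Qed.

Definition halts (orc : nat -> nat) (e x w : nat) : bool := negb (run orc w e x =? 0).

Lemma halts_Phi Y e x : (exists w, halts (chi Y) e x w = true) <-> exists y, Phi e Y x y.
Proof.
  unfold halts. split.
  - intros [w Hw]. destruct (run (chi Y) w e x) as [|y] eqn:E; [discriminate|].
    exists y. apply run_Phi. eauto.
  - intros [y Hy]. apply run_Phi in Hy. destruct Hy as [w Hw]. exists w.
    now rewrite Hw.
Qed.

Lemma computable_halts D (orc : nset -> nat -> nat -> nat) e v w :
  computable_on (lift D) (fun X y => orc X (pfst y) (psnd y)) ->
  computable_on D e -> computable_on D v -> computable_on D w ->
  computable_on D (fun X x => Nat.b2n (halts (orc X x) (e X x) (v X x) (w X x))).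
Proof.
  intros Ho He Hv Hw. unfold halts.
  assert (H := computable_run D orc w e v Ho Hw He Hv). effective.
Qed.

(** The oracle [Z X x] of the simulated program need not be the oracle [X] at hand; it only
    has to be computable from it.  This is also how oracles are substituted. *)
Lemma computable_Phi D (Z : nset -> nat -> nset) e v F :
  computable_on (lift D) (fun X y => chi (Z X (pfst y)) (psnd y)) ->
  computable_on D e -> computable_on D v ->
  (forall X x, D X x -> Phi (e X x) (Z X x) (v X x) (F X x)) ->
  computable_on D F.
Proof.
  intros Hz He Hv H.
  set (t := fun X x w => halts (chi (Z X x)) (e X x) (v X x) w).
  assert (Ht : forall X x, D X x -> exists w, t X x w = true).
  { intros X x Hx. apply halts_Phi. eauto. }
  assert (Cm : computable_on D (fun X x => mu (t X x))).
  { apply computable_mu; [|exact Ht]. unfold t.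
    apply (computable_halts _ (fun X y => chi (Z X (pfst y))) (fun X y => e X (pfst y))
      (fun X y => v X (pfst y))); effective.
    refine (computable_apply2 D _ (fun X x z => chi (Z X x) z) _ _ Hz _ _ _); effective. }
  apply computable_ext with
    (G := fun X x => pred (run (chi (Z X x)) (mu (t X x)) (e X x) (v X x))).
  - apply computable_pred. now apply (computable_run D (fun X x => chi (Z X x))).
  - intros X x Hx. specialize (Ht X x Hx). apply mu_spec in Ht. destruct Ht as [Ht _].
    unfold t, halts in Ht.
    destruct (run (chi (Z X x)) (mu (t X x)) (e X x) (v X x)) as [|y] eqn:E.
    + unfold t, halts in E. rewrite E in Ht. discriminate.
    + apply (Phi_fun (e X x) (Z X x) (v X x)); [auto|]. apply run_Phi. eauto.
Qed.

Lemma computable_subst D E (Z : nset -> nat -> nset) F v :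
  computable_on E F ->
  computable_on (lift D) (fun X y => chi (Z X (pfst y)) (psnd y)) ->
  computable_on D v ->
  (forall X x, D X x -> E (Z X x) (v X x)) ->
  computable_on D (fun X x => F (Z X x) (v X x)).
Proof.
  intros [c Hc] Hz Hv H.
  apply (computable_Phi D Z (fun _ _ => encode c) v); auto.
  - effective.
  - intros X x Hx. exists c. auto.
Qed.

(** * Indices, the recursion theorem and the jump *)

Fixpoint const_code (n : nat) : code :=
  match n with 0 => Zero | S n => Comp Succ (const_code n) end.

Lemma eval_const_code X n x y : eval X (const_code n) x y <-> y = n.
Proof.
  revert y. induction n as [|n IH]; intros y; cbn [const_code eval]; [reflexivity|].
  split.
  - intros (u & Hu & ->). apply IH in Hu. congruence.
  - intros ->. exists n. split; [now apply IH|reflexivity].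
Qed.

Definition const_index (n : nat) : nat := encode (const_code n).

Lemma computable_const_index D F :
  computable_on D F -> computable_on D (fun X x => const_index (F X x)).
Proof.
  intros HF.
  refine (computable_primrec D (fun _ _ n => const_index n)
    (fun _ _ _ r => 6 + 4 * ⟨encode Succ, r⟩) F _ _ _ _); effective.
Qed.

Definition smn (e p : nat) : nat :=
  6 + 4 * ⟨e, 5 + 4 * ⟨const_index p, encode (Pair Fst Snd)⟩⟩.

Lemma smn_Phi e p X x y : Phi (smn e p) X x y <-> Phi e X ⟨p, x⟩ y.
Proof.
  destruct (encode_surj e) as [c <-].
  change (smn (encode c) p) with
    (encode (Comp c (Pair (const_code p) (Pair Fst Snd)))).
  split.
  - intros (d & E & H). apply encode_inj in E. subst d. exists c. split; [reflexivity|].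
    cbn [eval] in H. destruct H as (u & (a & b & Ha & (a' & b' & -> & -> & ->) & ->) & H).
    apply eval_const_code in Ha. subst a.
    fold (pfst x) (psnd x) in H. now rewrite pair_eta in H.
  - intros (d & E & H). apply encode_inj in E. subst d.
    eexists. split; [reflexivity|]. cbn [eval]. exists ⟨p, x⟩. split; [|assumption].
    exists p, x. repeat split; [now apply eval_const_code|].
    exists (pfst x), (psnd x). repeat split. symmetry; apply pair_eta.
Qed.

Lemma computable_smn D F G : computable_on D F -> computable_on D G ->
  computable_on D (fun X x => smn (F X x) (G X x)).
Proof.
  intros HF HG. unfold smn. effective. now apply computable_const_index.
Qed.

(** Kleene's recursion theorem, packaged for definitions by recursion along [rank]: [F] is
    computable if it can be computed from an index that is correct at smaller rank.
    The index is the first component of the argument. *)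
Lemma computable_fix D F (rank : nat -> nat) :
  computable_on
    (fun X y => D X (psnd y) /\ forall X' x', D X' x' -> rank x' < rank (psnd y) ->
       Phi (pfst y) X' x' (F X' x'))
    (fun X y => F X (psnd y)) ->
  computable_on D F.
Proof.
  intros [c Hc].
  assert (Hs : computable_on everywhere (fun _ y => ⟨smn (pfst y) (pfst y), psnd y⟩)).
  { effective. apply computable_smn; effective. }
  destruct Hs as [d Hd].
  set (v := encode (Comp c d)).
  assert (E : forall X x y, eval X c ⟨smn v v, x⟩ y -> Phi (smn v v) X x y).
  { intros X x y H. apply smn_Phi. exists (Comp c d). split; [reflexivity|].
    cbn [eval]. exists ⟨smn v v, x⟩. split; [|assumption].
    specialize (Hd X ⟨v, x⟩ I). now rewrite pfst_pair, psnd_pair in Hd. }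
  assert (H : forall n X x, rank x < n -> D X x -> Phi (smn v v) X x (F X x)).
  { intros n. induction n as [|n IH]; intros X x Hn Hx; [lia|].
    apply E. specialize (Hc X ⟨smn v v, x⟩). rewrite pfst_pair, psnd_pair in Hc.
    apply Hc. split; [assumption|]. intros X' x' Hx' L. apply IH; [lia|assumption]. }
  destruct (encode_surj (smn v v)) as [f Ef]. exists f. intros X x Hx.
  destruct (H (S (rank x)) X x) as (g & Eg & Hg); [lia|assumption|].
  rewrite <- Ef in Eg. apply encode_inj in Eg. now subst g.
Qed.

(** Σ_1 questions about [X] reduce to membership in the jump of [X] by a function that does
    not depend on [X]: freeze the input [x] inside the program of the search. *)
Lemma jump_index D (t : nset -> nat -> nat -> bool) :
  computable_on (lift D) (fun X y => Nat.b2n (t X (pfst y) (psnd y))) ->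
  exists h : nat -> nat, computable_on everywhere (fun _ x => h x) /\
    forall X x, D X x -> (jump X (h x) <-> exists w, t X x w = true).
Proof.
  intros Ht. destruct (semidecidable D t Ht) as [c Hc].
  exists (fun x => 6 + 4 * ⟨encode c, const_index x⟩). split.
  - effective. apply computable_const_index. effective.
  - intros X x Hx. rewrite <- Hc by assumption. unfold jump.
    change (6 + 4 * ⟨encode c, const_index x⟩) with (encode (Comp c (const_code x))).
    split.
    + intros (y & d & E & H). apply encode_inj in E. subst d. exists y.
      cbn [eval] in H. destruct H as (u & Hu & H). apply eval_const_code in Hu.
      now subst u.
    + intros [y Hy]. exists y. eexists. split; [reflexivity|].
      cbn [eval]. exists x. split; [now apply eval_const_code|assumption].
Qed.

Definition enumerated_by (t : nat -> nat -> bool) : nset := fun u => exists w, t u w = true.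

Lemma computable_from_jump D E (t : nset -> nat -> nat -> bool) (Z : nset -> nat -> nset) a :
  computable_on (lift D) (fun X y => Nat.b2n (t X (pfst y) (psnd y))) ->
  computable_on (lift E) (fun X y => chi (jump (Z X (pfst y))) (psnd y)) ->
  computable_on E a ->
  (forall X x, E X x -> D (Z X x) (a X x)) ->
  computable_on E (fun X x => chi (enumerated_by (t (Z X x))) (a X x)).
Proof.
  intros Ht Hz Ha H. destruct (jump_index D t Ht) as (h & Hh & Hj).
  apply computable_ext with (G := fun X x => chi (jump (Z X x)) (h (a X x))).
  - refine (computable_apply2 E E (fun X x z => chi (jump (Z X x)) z) (fun _ x => x)
      (fun X x => h (a X x)) Hz _ _ _); effective.
    apply (computable_comp E everywhere a (fun _ x => h x)); auto. easy.
  - intros X x Hx. apply chi_iff. symmetry. apply Hj. auto.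
Qed.

(** * The finite injury construction *)

(** [ent i w] says that [w] witnesses [i ∈ source]; [T C j w] says that with oracle [C] a
    computation with use at most [w] puts [j] into the set that is to be controlled.
    The construction enumerates a set [built] so that [source] and [outcome], the latter
    taken with oracle [built], can be computed from each other. *)
Section Injury.
Variable ent : nat -> nat -> bool.
Variable T : (nat -> bool) -> nat -> nat -> bool.

(** The stage [⟨i, w⟩] is devoted to [i]; by minimality of [w] each [i] enters at one stage
    at most. *)
Definition enters (s : nat) : bool :=
  ent (pfst s) (psnd s) && negb (exists_below (ent (pfst s)) (psnd s)).

Definition entered (i s : nat) : bool := exists_below (fun n => enters n && (pfst n =? i)) s.

(** A history of [s] stages is the nested pair of the actions at these stages, the latest
    one first; the action [S z] is the enumeration of [z] and [0] means no action. *)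
Definition in_hist (s h z : nat) : bool :=
  exists_below (fun i => pfst (Nat.iter i psnd h) =? S z) s.

Definition use (C : nat -> bool) (s j : nat) : nat :=
  if exists_below (T C j) s then least_below (T C j) s else 0.

(** The sum of the uses for [j < i] dominates each of them, so enumerating [⟨i, mark C s i⟩]
    does not injure them. *)
Fixpoint mark (C : nat -> bool) (s i : nat) : nat :=
  match i with 0 => 0 | S j => mark C s j + use C s j end.

Definition new (C : nat -> bool) (n : nat) : nat :=
  if enters n then S ⟨pfst n, mark C n (pfst n)⟩ else 0.

Fixpoint hist (s : nat) : nat :=
  match s with 0 => 0 | S n => ⟨new (in_hist n (hist n)) n, hist n⟩ end.

Definition built_at (s : nat) : nat -> bool := in_hist s (hist s).

Definition marker (s i : nat) : nat := ⟨i, mark (built_at s) s i⟩.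

Lemma built_at_S s z : built_at (S s) z = true <->
  built_at s z = true \/ enters s = true /\ z = marker s (pfst s).
Proof.
  unfold built_at, in_hist. rewrite !exists_below_true. cbn [hist]. split.
  - intros (i & Hi & E). apply Nat.eqb_eq in E. destruct i as [|i].
    + right. cbn in E. rewrite pfst_pair in E. unfold new in E.
      destruct (enters s); [|discriminate]. split; [reflexivity|].
      injection E as E. symmetry. exact E.
    + left. exists i. split; [lia|]. rewrite Nat.iter_succ_r, psnd_pair in E.
      now apply Nat.eqb_eq.
  - intros [(i & Hi & E)|[E ->]].
    + exists (S i). split; [lia|]. now rewrite Nat.iter_succ_r, psnd_pair.
    + exists 0. split; [lia|]. cbn. rewrite pfst_pair. unfold new. rewrite E.
      apply Nat.eqb_refl.
Qed.

Lemma built_at_0 z : built_at 0 z = false.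
Proof. reflexivity. Qed.

Lemma built_at_mono s t z : s <= t -> built_at s z = true -> built_at t z = true.
Proof.
  induction 1 as [|t L IH]; [auto|]. intros H. apply built_at_S. left. auto.
Qed.

Lemma built_at_true s z : built_at s z = true <->
  exists n, n < s /\ enters n = true /\ z = marker n (pfst n).
Proof.
  induction s as [|s IH].
  - rewrite built_at_0. split; [discriminate|]. intros (n & L & _). lia.
  - rewrite built_at_S, IH. split.
    + intros [(n & L & H)|H]; [exists n|exists s]; (split; [lia|assumption]).
    + intros (n & L & H). destruct (Nat.eq_dec n s) as [->|]; [auto|].
      left. exists n. split; [lia|assumption].
Qed.

Definition built (z : nat) : bool :=
  if excluded_middle_informative (exists s, built_at s z = true) then true else false.

Lemma built_true z : built z = true <-> exists s, built_at s z = true.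
Proof.
  unfold built. destruct (excluded_middle_informative (exists s, built_at s z = true));
    split; auto; discriminate.
Qed.

Lemma built_marker z : built z = true <-> exists n, enters n = true /\ z = marker n (pfst n).
Proof.
  rewrite built_true. split.
  - intros [s Hs]. apply built_at_true in Hs. destruct Hs as (n & _ & H). eauto.
  - intros [n H]. exists (S n). apply built_at_true. exists n. split; [lia|assumption].
Qed.

Definition source : nset := fun i => exists w, ent i w = true.

Lemma source_enters i : source i <-> exists n, enters n = true /\ pfst n = i.
Proof.
  split.
  - intros H. apply mu_spec in H. destruct H as [H1 H2].
    exists ⟨i, mu (ent i)⟩. unfold enters. rewrite pfst_pair, psnd_pair.
    split; [|reflexivity]. rewrite H1, andb_true_l.
    destruct (exists_below (ent i) (mu (ent i))) eqn:E; [|reflexivity].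
    apply exists_below_true in E. destruct E as (m & L & E). rewrite H2 in E by assumption.
    discriminate.
  - intros (n & E & <-). unfold enters in E. apply andb_true_iff in E.
    exists (psnd n). tauto.
Qed.

Lemma entered_true i s : entered i s = true <->
  exists n, n < s /\ enters n = true /\ pfst n = i.
Proof.
  unfold entered. rewrite exists_below_true. split; intros (n & L & H); exists n;
    rewrite ?andb_true_iff, ?Nat.eqb_eq in *; tauto.
Qed.

Lemma enters_once n n' : enters n = true -> enters n' = true -> pfst n = pfst n' -> n = n'.
Proof.
  unfold enters. rewrite !andb_true_iff, !negb_true_iff. intros [A A'] [C C'] E.
  rewrite <- (pair_eta n), <- (pair_eta n'), E. f_equal. f_equal.
  rewrite E in *.
  destruct (Nat.lt_trichotomy (psnd n) (psnd n')) as [L|[L|L]]; [|assumption|]; exfalso.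
  - apply not_true_iff_false in C'. apply C'. apply exists_below_true. eauto.
  - apply not_true_iff_false in A'. apply A'. apply exists_below_true. eauto.
Qed.

(** Computations for [j < k] are never injured from such a stage on, because only markers of
    numbers up to [j] may injure them. *)
Definition settled (k s : nat) : Prop :=
  forall n, s <= n -> enters n = true -> k <= pfst n.

Lemma settled_iff k s : settled k s <-> forall i, i < k -> source i -> entered i s = true.
Proof.
  split.
  - intros H i Hi HK. apply source_enters in HK. destruct HK as (n & En & <-).
    apply entered_true. exists n. repeat split; auto.
    destruct (le_lt_dec s n) as [L|]; [|assumption]. specialize (H n L En). lia.
  - intros H n L En. destruct (le_lt_dec k (pfst n)) as [|C]; [assumption|].
    specialize (H (pfst n) C). rewrite entered_true in H.
    destruct H as (n' & L' & En' & E); [apply source_enters; eauto|].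
    apply enters_once in E; [lia|assumption..].
Qed.

Lemma settled_mono k k' s s' : k' <= k -> s <= s' -> settled k s -> settled k' s'.
Proof. intros L L' H n Hn En. specialize (H n ltac:(lia) En). lia. Qed.

Lemma settled_exists k : exists s, settled k s.
Proof.
  induction k as [|k [s Hs]].
  - exists 0. intros n _ _. lia.
  - destruct (excluded_middle_informative (exists n, s <= n /\ enters n = true /\ pfst n = k))
      as [(m & Lm & Em & Ek)|N].
    + exists (S m). intros n L En. specialize (Hs n ltac:(lia) En).
      destruct (Nat.eq_dec (pfst n) k) as [E|]; [|lia].
      rewrite <- Ek in E. apply enters_once in E; [lia|assumption..].
    + exists s. intros n L En. specialize (Hs n L En).
      destruct (Nat.eq_dec (pfst n) k) as [E|]; [|lia]. exfalso. apply N. eauto.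
Qed.

Hypothesis T_use : forall C C' j w, (forall z, z < w -> C z = C' z) -> T C j w = T C' j w.

Definition outcome (j : nat) : Prop := exists w, T built j w = true.

Definition found (j s : nat) : bool := exists_below (T (built_at s) j) s.

Lemma use_found s j : found j s = true -> use (built_at s) s j = least_below (T (built_at s) j) s.
Proof. unfold found, use. now intros ->. Qed.

Lemma use_not_found s j : found j s = false -> use (built_at s) s j = 0.
Proof. unfold found, use. now intros ->. Qed.

Lemma mark_ge C s i j : j < i -> use C s j <= mark C s i.
Proof.
  induction i as [|i IH]; intros L; [lia|]. cbn [mark].
  destruct (Nat.eq_dec j i) as [->|]; [lia|]. specialize (IH ltac:(lia)). lia.
Qed.

(** An element enumerated after stage [s] is the marker of some [i > j], and as long as the
    computation for [j] stands this marker lies above its use. *)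
Lemma found_permanent j s : settled (S j) s -> found j s = true ->
  forall t, s <= t -> found j t = true /\ use (built_at t) t j = use (built_at s) s j /\
    forall z, z < use (built_at s) s j -> built_at t z = built_at s z.
Proof.
  intros Hs Hf. pose proof (use_found s j Hf) as Eu.
  set (w := use (built_at s) s j) in *.
  assert (Hw : w < s /\ T (built_at s) j w = true /\ forall m, m < w -> T (built_at s) j m = false).
  { rewrite Eu. unfold found, exists_below in Hf. apply Nat.ltb_lt in Hf.
    destruct (least_below_spec (T (built_at s) j) s) as [?|[? _]]; [assumption|lia]. }
  destruct Hw as (Hws & Hw1 & Hw2).
  intros t L. induction L as [|t L (IHf & IHu & IHz)]; [auto|].
  assert (A : forall z, z < w -> built_at (S t) z = built_at s z).
  { intros z Hz. rewrite <- (IHz z Hz). apply eq_iff_eq_true. rewrite built_at_S.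
    split; [|auto]. intros [?|[En ->]]; [assumption|]. exfalso.
    specialize (Hs t L En). pose proof (mark_ge (built_at t) t (pfst t) j Hs) as M.
    unfold marker in Hz. pose proof (pair_ge (pfst t) (mark (built_at t) t (pfst t))). lia. }
  assert (E : forall v, v <= w -> T (built_at (S t)) j v = T (built_at s) j v).
  { intros v Hv. apply T_use. intros z Hz. apply A. lia. }
  assert (M : least_below (T (built_at (S t)) j) (S t) = w).
  { apply least_below_eq; [lia| |].
    - now rewrite E by lia.
    - intros m Hm. rewrite E by lia. auto. }
  assert (F : found j (S t) = true).
  { unfold found, exists_below. rewrite M. apply Nat.ltb_lt. lia. }
  split; [assumption|]. split; [|assumption]. rewrite use_found by assumption.
  exact M.
Qed.

Lemma found_outcome j s : settled (S j) s -> found j s = true -> outcome j.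
Proof.
  intros Hs Hf. exists (use (built_at s) s j).
  pose proof (found_permanent j s Hs Hf) as P.
  assert (E : T (built_at s) j (use (built_at s) s j) = true).
  { rewrite use_found by assumption. unfold found, exists_below in Hf. apply Nat.ltb_lt in Hf.
    destruct (least_below_spec (T (built_at s) j) s) as [?|[? _]]; [tauto|lia]. }
  rewrite <- E. apply T_use. intros z Hz. apply eq_iff_eq_true. rewrite built_true. split.
  - intros [t Ht]. destruct (le_lt_dec s t) as [L|L].
    + destruct (P t L) as (_ & _ & H). now rewrite H in Ht.
    + apply built_at_mono with t; [lia|assumption].
  - eauto.
Qed.

Lemma built_at_limit w : exists t0, forall t, t0 <= t -> forall z, z < w -> built_at t z = built z.
Proof.
  induction w as [|w [t0 IH]].
  - exists 0. intros; lia.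
  - assert (H : exists t1, forall t, t1 <= t -> built_at t w = built w).
    { destruct (built w) eqn:E.
      - apply built_true in E. destruct E as [s Hs]. exists s. intros t L.
        now apply built_at_mono with s.
      - exists 0. intros t _. apply not_true_iff_false. intros H.
        apply not_true_iff_false in E. apply E. apply built_true. eauto. }
    destruct H as [t1 H]. exists (t0 + t1). intros t L z Hz.
    destruct (Nat.eq_dec z w) as [->|]; [apply H; lia|apply IH; lia].
Qed.

Lemma outcome_found j : outcome j -> exists t0, forall t, t0 <= t -> found j t = true.
Proof.
  intros [w Hw]. destruct (built_at_limit w) as [t0 H]. exists (S (t0 + w)). intros t L.
  apply exists_below_true. exists w. split; [lia|]. rewrite <- Hw. apply T_use.
  intros z Hz. apply H; [lia|assumption].
Qed.

(** This reduces [outcome] to [source]: once a stage with [settled (S j) s] is known,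
    a Σ_1 question remains. *)
Lemma outcome_iff_found j s : settled (S j) s ->
  (outcome j <-> exists t, (s <=? t) && found j t = true).
Proof.
  intros Hs. split.
  - intros H. apply outcome_found in H. destruct H as [t0 H]. exists (s + t0).
    rewrite (H (s + t0)) by lia. apply andb_true_iff. split; [|reflexivity].
    apply Nat.leb_le. lia.
  - intros [t H]. apply andb_true_iff in H. destruct H as [L F]. apply Nat.leb_le in L.
    apply found_outcome with t; [|assumption]. now apply settled_mono with (S j) s.
Qed.

(** A new computation for some [j < k] appearing after [s] would be permanent, so that
    [outcome j] would hold and [j] would have been found by [s]. *)
Lemma marker_final k s : settled k s -> (forall j, j < k -> outcome j -> found j s = true) ->
  forall t, s <= t -> marker t k = marker s k.
Proof.
  intros Hs HW t L. unfold marker. f_equal. f_equal.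
  assert (H : forall i, i <= k -> mark (built_at t) t i = mark (built_at s) s i); [|auto].
  induction i as [|j IH]; intros Hi; cbn [mark]; [reflexivity|].
  rewrite IH by lia. f_equal.
  assert (Hj : settled (S j) s) by (apply settled_mono with k s; auto).
  destruct (found j s) eqn:F.
  - now destruct (found_permanent j s Hj F t L) as (_ & ? & _).
  - rewrite (use_not_found s j F). apply use_not_found.
    apply not_true_iff_false. intros G.
    enough (found j s = true) by congruence.
    apply HW; [lia|]. apply found_outcome with t; [|assumption].
    now apply settled_mono with (S j) s.
Qed.

(** With [U] the set [outcome] and [C] the set [built], [ready U C k s t] can be tested
    at a stage [t]; it ensures that the marker of [k] is final at [t] and that [k] does
    not enter later. *)
Definition ready (U : nat -> bool) (C : nat -> bool) (k s t : nat) : bool :=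
  (s <=? t) && negb (exists_below (fun j => U j && negb (found j t)) k)
  && (negb (C (marker t k)) || entered k t).

Variable U : nat -> bool.
Hypothesis U_outcome : forall j, U j = true <-> outcome j.

Lemma ready_found k s t : ready U built k s t = true ->
  s <= t /\ (forall j, j < k -> outcome j -> found j t = true) /\
  (built (marker t k) = true -> entered k t = true).
Proof.
  unfold ready. rewrite !andb_true_iff, orb_true_iff, !negb_true_iff, Nat.leb_le.
  intros [[L H1] H2]. split; [assumption|]. split.
  - intros j Hj Hw. destruct (found j t) eqn:F; [reflexivity|].
    enough (exists_below (fun j => U j && negb (found j t)) k = true) by congruence.
    apply exists_below_true. exists j. split; [assumption|].
    apply U_outcome in Hw. now rewrite Hw, F.
  - intros HB. destruct H2 as [H2|H2]; [congruence|assumption].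
Qed.

Lemma ready_settled k s t : settled k s -> ready U built k s t = true -> settled (S k) t.
Proof.
  intros Hs Hr. apply ready_found in Hr. destruct Hr as (L & HW & HB).
  assert (Ht : settled k t) by now apply settled_mono with k s.
  apply settled_iff. intros i Hi HK. apply Nat.lt_succ_r in Hi.
  destruct (Nat.eq_dec i k) as [->|].
  2: { apply (proj1 (settled_iff k t) Ht); [lia|assumption]. }
  apply source_enters in HK. destruct HK as (n & En & Ek).
  destruct (le_lt_dec t n) as [Ln|Ln].
  2: { apply entered_true. eauto. }
  apply HB. apply built_marker. exists n. split; [assumption|]. rewrite Ek. symmetry.
  now apply marker_final.
Qed.

Lemma ready_exists k s : settled k s -> exists t, ready U built k s t = true.
Proof.
  intros Hs.
  assert (H : exists t, s <= t /\
    forall j, j < k -> outcome j -> forall t', t <= t' -> found j t' = true).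
  { clear Hs. induction k as [|k (t & L & IH)].
    - exists s. split; [lia|]. intros; lia.
    - destruct (excluded_middle_informative (outcome k)) as [Hw|Hw].
      + destruct (outcome_found k Hw) as [t0 H]. exists (t + t0). split; [lia|].
        intros j Hj Hwj t' L'. destruct (Nat.eq_dec j k) as [->|]; [apply H; lia|].
        apply IH; [lia|assumption|lia].
      + exists t. split; [assumption|]. intros j Hj Hwj t' L'.
        destruct (Nat.eq_dec j k) as [->|]; [contradiction|]. apply IH; [lia|assumption|lia]. }
  destruct H as (t & L & H). destruct (settled_exists (S k)) as [t1 H1].
  exists (t + t1). unfold ready.
  rewrite !andb_true_iff, orb_true_iff, !negb_true_iff, Nat.leb_le. repeat split.
  - lia.
  - apply not_true_iff_false. rewrite exists_below_true. intros (j & Hj & E).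
    apply andb_true_iff in E. destruct E as [E F]. apply U_outcome in E.
    rewrite (H j Hj E) in F by lia. discriminate.
  - destruct (built (marker (t + t1) k)) eqn:E; [right|auto].
    apply built_marker in E. destruct E as (n & En & E). apply pair_inj in E.
    apply (proj1 (settled_iff (S k) (t + t1))); [|lia|].
    + apply settled_mono with (S k) t1; [lia|lia|assumption].
    + apply source_enters. exists n. split; [assumption|]. symmetry. tauto.
Qed.

(** The reduction of [source] to [built] and [outcome]: search for a stage by which [k] is
    decided, given a stage by which the smaller numbers are. *)
Fixpoint stage (C : nat -> bool) (k : nat) : nat :=
  match k with 0 => 0 | S k => mu (ready U C k (stage C k)) end.

Lemma stage_settled k : settled k (stage built k).
Proof.
  induction k as [|k IH]; cbn [stage]; [intros n _ _; lia|].
  apply ready_settled with (stage built k); [assumption|].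
  apply mu_spec. now apply ready_exists.
Qed.

Lemma source_stage k : source k <-> entered k (stage built (S k)) = true.
Proof.
  split.
  - intros H. apply (proj1 (settled_iff (S k) _) (stage_settled (S k))); [lia|assumption].
  - intros H. apply entered_true in H. apply source_enters. destruct H as (n & _ & H). eauto.
Qed.

(** The marker of [0] protects no computation and stays at [⟨0, 0⟩]. *)
Lemma source_0_iff : source 0 <-> built ⟨0, 0⟩ = true.
Proof.
  rewrite source_enters, built_marker. unfold marker. split.
  - intros (n & En & E). exists n. now rewrite E.
  - intros (n & En & E). apply pair_inj in E. exists n. split; [assumption|].
    symmetry. tauto.
Qed.
End Injury.

(** * The construction as an enumeration operator *)

Definition joined (orc : nat -> nat) (C : nat -> bool) (z : nat) : nat :=
  if pfst z =? 0 then orc (psnd z) else Nat.b2n (C (psnd z)).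

Definition join (X : nset) (C : nat -> bool) : nset := fun z => joined (chi X) C z = 1.

Lemma chi_join X C z : chi (join X C) z = joined (chi X) C z.
Proof.
  unfold join. destruct (joined (chi X) C z) as [|[|n]] eqn:E.
  - apply chi_false. congruence.
  - now apply chi_true.
  - exfalso. unfold joined, chi in E. destruct (pfst z =? 0).
    + destruct (excluded_middle_informative (X (psnd z))); discriminate.
    + destruct (C (psnd z)); discriminate.
Qed.

(** The set to be coded at level [P = ⟨q, k⟩]: the bit is the halting of program [q] on
    input [P], and it is followed by the jump of [X]. *)
Definition entry (X : nset) (P i w : nat) : bool :=
  if i =? 0 then halts (chi X) (pfst P) P w else halts (chi X) (pred i) (pred i) w.

Definition succ_level (P : nat) : nat := ⟨pfst P, S (psnd P)⟩.

(** The operator to be controlled is the one that program [e] enumerates at the next level,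
    applied to [X] joined with the set [C] under construction. *)
Definition halting_test (X : nset) (e P : nat) (C : nat -> bool) (j w : nat) : bool :=
  halts (joined (chi X) C) e ⟨e, ⟨succ_level P, j⟩⟩ w.

Lemma halts_agree orc orc' e x w : (forall z, z < w -> orc z = orc' z) ->
  halts orc e x w = halts orc' e x w.
Proof. intros H. unfold halts. now rewrite (run_agree orc orc' w e x H). Qed.

Lemma halting_test_use X e P C C' j w : (forall z, z < w -> C z = C' z) ->
  halting_test X e P C j w = halting_test X e P C' j w.
Proof.
  intros H. apply halts_agree. intros z Hz. unfold joined.
  rewrite H; [reflexivity|]. pose proof (psnd_le z). lia.
Qed.

Lemma computable_entry D P i w :
  computable_on D P -> computable_on D i -> computable_on D w ->
  computable_on D (fun X x => Nat.b2n (entry X (P X x) (i X x) (w X x))).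
Proof.
  intros HP Hi Hw. unfold entry. effective.
  - apply (computable_halts D (fun X _ => chi X) (fun X x => pfst (P X x)) P w); effective.
  - apply (computable_halts D (fun X _ => chi X) (fun X x => pred (i X x))
      (fun X x => pred (i X x)) w); effective.
Qed.

Lemma computable_in_hist D s h z :
  computable_on D s -> computable_on D h -> computable_on D z ->
  computable_on D (fun X x => Nat.b2n (in_hist (s X x) (h X x) (z X x))).
Proof.
  intros Hs Hh Hz.
  apply (computable_exists_below D (fun X x i => pfst (Nat.iter i psnd (h X x)) =? S (z X x)) s);
    [|assumption].
  effective. apply (computable_iter _ (fun _ _ r => psnd r)); effective.
Qed.

Lemma computable_enters D P s :
  computable_on D P -> computable_on D s ->
  computable_on D (fun X x => Nat.b2n (enters (entry X (P X x)) (s X x))).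
Proof.
  intros HP Hs. unfold enters. effective.
  - apply (computable_entry D P (fun X x => pfst (s X x)) (fun X x => psnd (s X x))); effective.
  - apply (computable_exists_below D (fun X x w => entry X (P X x) (pfst (s X x)) w)); effective.
    apply (computable_entry _ (fun X y => P X (pfst y)) (fun X y => pfst (s X (pfst y)))); effective.
Qed.

Lemma computable_halting_test D e P s h j w :
  computable_on D e -> computable_on D P -> computable_on D s -> computable_on D h ->
  computable_on D j -> computable_on D w ->
  computable_on D (fun X x =>
    Nat.b2n (halting_test X (e X x) (P X x) (in_hist (s X x) (h X x)) (j X x) (w X x))).
Proof.
  intros He HP Hs Hh Hj Hw. unfold halting_test.
  apply (computable_halts D (fun X x => joined (chi X) (in_hist (s X x) (h X x))) e
    (fun X x => ⟨e X x, ⟨succ_level (P X x), j X x⟩⟩) w); unfold succ_level; effective.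
  unfold joined. effective.
  apply (computable_in_hist _ (fun X y => s X (pfst y)) (fun X y => h X (pfst y))); effective.
Qed.

Lemma computable_search D e P s h j n :
  computable_on D e -> computable_on D P -> computable_on D s ->
  computable_on D h -> computable_on D j -> computable_on D n ->
  computable_on D (fun X x =>
    least_below (halting_test X (e X x) (P X x) (in_hist (s X x) (h X x)) (j X x)) (n X x)).
Proof.
  intros He HP Hs Hh Hj Hn.
  apply (computable_least_below D (fun X x w =>
    halting_test X (e X x) (P X x) (in_hist (s X x) (h X x)) (j X x) w)); [|assumption].
  apply (computable_halting_test _ (fun X y => e X (pfst y)) (fun X y => P X (pfst y))
    (fun X y => s X (pfst y)) (fun X y => h X (pfst y)) (fun X y => j X (pfst y))); effective.
Qed.

Lemma computable_mark D e P s h n i :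
  computable_on D e -> computable_on D P -> computable_on D s ->
  computable_on D h -> computable_on D n -> computable_on D i ->
  computable_on D (fun X x =>
    mark (halting_test X (e X x) (P X x)) (in_hist (s X x) (h X x)) (n X x) (i X x)).
Proof.
  intros He HP Hs Hh Hn Hi.
  refine (computable_primrec D
    (fun X x i => mark (halting_test X (e X x) (P X x)) (in_hist (s X x) (h X x)) (n X x) i)
    (fun X x j r => r + use (halting_test X (e X x) (P X x)) (in_hist (s X x) (h X x)) (n X x) j)
    i _ _ _ _); effective.
  - exact (computable_const D 0).
  - assert (H := computable_search (lift D) (fun X y => e X (pfst y)) (fun X y => P X (pfst y))
      (fun X y => s X (pfst y)) (fun X y => h X (pfst y))
      (fun X y => pfst (psnd y)) (fun X y => n X (pfst y))
      ltac:(effective) ltac:(effective) ltac:(effective) ltac:(effective) ltac:(effective)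
      ltac:(effective)).
    unfold use, exists_below. cbv beta in H. effective.
Qed.

Lemma computable_hist D e P s :
  computable_on D e -> computable_on D P -> computable_on D s ->
  computable_on D (fun X x => hist (entry X (P X x)) (halting_test X (e X x) (P X x)) (s X x)).
Proof.
  intros He HP Hs.
  refine (computable_primrec D
    (fun X x s => hist (entry X (P X x)) (halting_test X (e X x) (P X x)) s)
    (fun X x n r => ⟨new (entry X (P X x)) (halting_test X (e X x) (P X x)) (in_hist n r) n, r⟩)
    s _ _ _ _); effective.
  - exact (computable_const D 0).
  - unfold new. effective.
    + apply (computable_enters _ (fun X y => P X (pfst y))); effective.
    + apply (computable_mark _ (fun X y => e X (pfst y)) (fun X y => P X (pfst y))
        (fun X y => pfst (psnd y)) (fun X y => psnd (psnd y)) (fun X y => pfst (psnd y))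
        (fun X y => pfst (pfst (psnd y)))); effective.
Qed.

Lemma computable_built_at D e P s z :
  computable_on D e -> computable_on D P -> computable_on D s -> computable_on D z ->
  computable_on D (fun X x =>
    Nat.b2n (built_at (entry X (P X x)) (halting_test X (e X x) (P X x)) (s X x) (z X x))).
Proof.
  intros He HP Hs Hz. unfold built_at. apply computable_in_hist; effective.
  now apply computable_hist.
Qed.

Lemma computable_marker D e P s i :
  computable_on D e -> computable_on D P -> computable_on D s -> computable_on D i ->
  computable_on D (fun X x =>
    marker (entry X (P X x)) (halting_test X (e X x) (P X x)) (s X x) (i X x)).
Proof.
  intros He HP Hs Hi. unfold marker, built_at.
  assert (H := computable_hist D e P s He HP Hs).
  assert (M := computable_mark D e P s _ s i He HP Hs H Hs Hi).
  cbv beta in M. effective.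
Qed.

Lemma computable_found D e P j s :
  computable_on D e -> computable_on D P -> computable_on D j -> computable_on D s ->
  computable_on D (fun X x =>
    Nat.b2n (found (entry X (P X x)) (halting_test X (e X x) (P X x)) (j X x) (s X x))).
Proof.
  intros He HP Hj Hs. unfold found, built_at.
  assert (H := computable_hist D e P s He HP Hs).
  assert (M := computable_search D e P s _ j s He HP Hs H Hj Hs).
  unfold exists_below. cbv beta in M. effective.
Qed.

Lemma computable_entered D P i s :
  computable_on D P -> computable_on D i -> computable_on D s ->
  computable_on D (fun X x => Nat.b2n (entered (entry X (P X x)) (i X x) (s X x))).
Proof.
  intros HP Hi Hs.
  apply (computable_exists_below D (fun X x n => enters (entry X (P X x)) n && (pfst n =? i X x)) s);
    [|assumption].
  effective. apply (computable_enters _ (fun X y => P X (pfst y))); effective.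
Qed.

Lemma enumerator_exists : exists d, forall X e P z,
  (exists y, eval X d ⟨e, ⟨P, z⟩⟩ y) <->
  exists s, built_at (entry X P) (halting_test X e P) s z = true.
Proof.
  destruct (semidecidable everywhere (fun X x s =>
    built_at (entry X (pfst (psnd x))) (halting_test X (pfst x) (pfst (psnd x))) s
      (psnd (psnd x)))) as [d Hd].
  - apply (computable_built_at _ (fun X y => pfst (pfst y)) (fun X y => pfst (psnd (pfst y)))
      (fun X y => psnd y) (fun X y => psnd (psnd (pfst y)))); effective.
  - exists d. intros X e P z. rewrite Hd by exact I. now autorewrite with pairs.
Qed.

(** Program [e] enumerates the sets built against program [e] itself. *)
Definition self_enumerating (e : nat) : Prop := forall X P z,
  (exists y, Phi e X ⟨e, ⟨P, z⟩⟩ y) <->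
  exists s, built_at (entry X P) (halting_test X e P) s z = true.

(** The program receives [e] as an input and is then given its own index. *)
Lemma self_enumerating_exists : exists e, self_enumerating e.
Proof.
  destruct enumerator_exists as [d Hd]. exists (encode d). intros X P z.
  rewrite <- Hd. split.
  - intros (y & c & E & H). apply encode_inj in E. subst c. eauto.
  - intros (y & H). exists y, d. auto.
Qed.

(** The next lemmas transfer the computability of the construction over [X] to any oracle
    that computes [X]. *)
Section Subst.
Variable e : nat.
Variables (E : nset -> nat -> Prop) (Z : nset -> nat -> nset) (P : nset -> nat -> nat).
Hypothesis HZ : computable_on (lift E) (fun X y => chi (Z X (pfst y)) (psnd y)).
Hypothesis HP : computable_on E P.

Lemma computable_found_in j t : computable_on E j -> computable_on E t ->
  computable_on E (fun X x => Nat.b2n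
    (found (entry (Z X x) (P X x)) (halting_test (Z X x) e (P X x)) (j X x) (t X x))).
Proof.
  intros Hj Ht. eapply computable_ext.
  - refine (computable_subst E everywhere Z (fun X v => Nat.b2n
      (found (entry X (pfst v)) (halting_test X e (pfst v)) (pfst (psnd v)) (psnd (psnd v))))
      (fun X x => ⟨P X x, ⟨j X x, t X x⟩⟩) _ HZ _ _); [|effective|easy].
    apply (computable_found _ (fun _ _ => e)); effective.
  - intros X x _. cbv beta. now autorewrite with pairs.
Qed.

Lemma computable_marker_in i t : computable_on E i -> computable_on E t ->
  computable_on E (fun X x =>
    marker (entry (Z X x) (P X x)) (halting_test (Z X x) e (P X x)) (t X x) (i X x)).
Proof.
  intros Hi Ht. eapply computable_ext.
  - refine (computable_subst E everywhere Z (fun X v =>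
      marker (entry X (pfst v)) (halting_test X e (pfst v)) (psnd (psnd v)) (pfst (psnd v)))
      (fun X x => ⟨P X x, ⟨i X x, t X x⟩⟩) _ HZ _ _); [|effective|easy].
    apply (computable_marker _ (fun _ _ => e)); effective.
  - intros X x _. cbv beta. now autorewrite with pairs.
Qed.

Lemma computable_entered_in i t : computable_on E i -> computable_on E t ->
  computable_on E (fun X x => Nat.b2n (entered (entry (Z X x) (P X x)) (i X x) (t X x))).
Proof.
  intros Hi Ht. eapply computable_ext.
  - refine (computable_subst E everywhere Z (fun X v =>
      Nat.b2n (entered (entry X (pfst v)) (pfst (psnd v)) (psnd (psnd v))))
      (fun X x => ⟨P X x, ⟨i X x, t X x⟩⟩) _ HZ _ _); [|effective|easy].
    apply computable_entered; effective.
  - intros X x _. cbv beta. now autorewrite with pairs.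
Qed.
End Subst.

Lemma computable_ready_in e E Z P (U C : nset -> nat -> nat -> bool) k s t :
  computable_on (lift E) (fun X y => chi (Z X (pfst y)) (psnd y)) ->
  computable_on (lift E) (fun X y => Nat.b2n (U X (pfst y) (psnd y))) ->
  computable_on (lift E) (fun X y => Nat.b2n (C X (pfst y) (psnd y))) ->
  computable_on E P -> computable_on E k -> computable_on E s -> computable_on E t ->
  computable_on E (fun X x => Nat.b2n
    (ready (entry (Z X x) (P X x)) (halting_test (Z X x) e (P X x)) (U X x) (C X x)
       (k X x) (s X x) (t X x))).
Proof.
  intros HZ HU HC HP Hk Hs Ht. unfold ready. effective.
  - apply (computable_exists_below E (fun X x j => U X x j &&
      negb (found (entry (Z X x) (P X x)) (halting_test (Z X x) e (P X x)) j (t X x))) k);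
      [|assumption].
    effective.
    apply (computable_found_in e _ (fun X y => Z X (pfst y)) (fun X y => P X (pfst y))); effective.
    apply (computable_apply2 E _ (fun X x z => chi (Z X x) z) _ _ HZ); effective.
  - now apply computable_marker_in.
  - now apply computable_entered_in.
Qed.

(** The case of [computable_from_jump] in which the oracle at hand is the jump itself. *)
Lemma computable_sigma E (Z : nset -> nat -> nset) (t : nset -> nat -> nat -> bool) a :
  computable_on everywhere (fun X y => Nat.b2n (t X (pfst y) (psnd y))) ->
  (forall X x, E X x -> X = jump (Z X x)) ->
  computable_on E a ->
  computable_on E (fun X x => chi (enumerated_by (t (Z X x))) (a X x)).
Proof.
  intros Ht HE Ha. apply (computable_from_jump everywhere E t Z a); auto; [|easy].
  apply computable_ext with (G := fun X u => chi X (psnd u)); [effective|].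
  intros X u Hu. now rewrite <- (HE X (pfst u) Hu).
Qed.

(** * Comparison along two ladders of jumps *)

(** A single reduction for all levels. *)
Definition below (U V : nat -> nset) : Prop :=
  computable_on (fun Y y => Y = V (pfst y)) (fun _ y => chi (U (pfst y)) (psnd y)).

(** Induction on the level, two levels at a time: if [U] reduces to [V] at level [k], then the
    same holds for the jumps, and the hypotheses climb from there to level [k + 2].  Since
    the reduction has to be uniform, the induction becomes an application of the recursion
    theorem: an index of the reduction at level [k] is part of the Σ_1 question that is
    put to the jump of [V]. *)
Lemma below_ladder (U V : nat -> nset) :
  (forall P, psnd P < 2 -> U P = V P) ->
  computable_on (fun Y y => Y = jump (U (pfst y)))
    (fun _ y => chi (U (succ_level (succ_level (pfst y)))) (psnd y)) ->
  computable_on (fun Y y => Y = V (succ_level (succ_level (pfst y))))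
    (fun _ y => chi (jump (V (pfst y))) (psnd y)) ->
  below U V.
Proof.
  intros H0 HU HV. apply (computable_fix _ _ (fun y => psnd (pfst y))).
  set (E := fun Y u => Y = V (pfst (psnd u)) /\ forall Y' y', Y' = V (pfst y') ->
    psnd (pfst y') < psnd (pfst (psnd u)) -> Phi (pfst u) Y' y' (chi (U (pfst y')) (psnd y'))).
  apply computable_ext with (G := fun Y u =>
    if psnd (pfst (psnd u)) <? 2 then chi Y (psnd (psnd u))
    else chi (U (pfst (psnd u))) (psnd (psnd u))).
  2: { intros Y u [HY _]. destruct (Nat.ltb_spec (psnd (pfst (psnd u))) 2); [|reflexivity].
       rewrite HY. now rewrite H0. }
  apply computable_if_lazy; [effective|effective|].
  set (E' := fun Y u => E Y u /\ (psnd (pfst (psnd u)) <? 2) = false).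
  (* The level two below the one asked for. *)
  set (Q := fun u => ⟨pfst (pfst (psnd u)), pred (pred (psnd (pfst (psnd u))))⟩).
  assert (SQ : forall Y u, E' Y u -> succ_level (succ_level (Q u)) = pfst (psnd u)).
  { intros Y u [_ H]. apply Nat.ltb_ge in H. unfold succ_level, Q. autorewrite with pairs.
    rewrite <- (pair_eta (pfst (psnd u))) at 3. f_equal. f_equal. lia. }
  assert (HVj : computable_on (lift E') (fun _ v => chi (jump (V (Q (pfst v)))) (psnd v))).
  { eapply computable_ext.
    - refine (computable_comp (lift E') _ (fun _ v => ⟨Q (pfst v), psnd v⟩) _ HV _ _).
      + unfold Q; effective.
      + intros Y v Hv. rewrite pfst_pair. rewrite (SQ Y (pfst v) Hv). apply Hv.
    - intros Y v _. cbv beta. now autorewrite with pairs. }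
  (* A question carries an index of the reduction, the level and the number asked about. *)
  set (E1 := fun X a => X = V (pfst (psnd a)) /\
    forall z, Phi (pfst a) X ⟨pfst (psnd a), z⟩ (chi (U (pfst (psnd a))) z)).
  assert (Ht : computable_on (lift E1) (fun X a =>
    Nat.b2n (halts (chi (U (pfst (psnd (pfst a))))) (psnd (psnd (pfst a)))
      (psnd (psnd (pfst a))) (psnd a)))).
  { apply (computable_halts (lift E1) (fun _ a => chi (U (pfst (psnd (pfst a)))))
      (fun _ a => psnd (psnd (pfst a))) (fun _ a => psnd (psnd (pfst a)))); [|effective..].
    apply (computable_Phi _ (fun X _ => X) (fun _ b => pfst (pfst (pfst b)))
      (fun _ b => ⟨pfst (psnd (pfst (pfst b))), psnd b⟩)); [effective..|].
    intros X b [_ Hb]. apply Hb. }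
  assert (HUj : computable_on (lift E') (fun _ v => chi (jump (U (Q (pfst v)))) (psnd v))).
  { eapply computable_ext.
    - refine (computable_from_jump E1 (lift E')
        (fun _ a w => halts (chi (U (pfst (psnd a)))) (psnd (psnd a)) (psnd (psnd a)) w)
        (fun _ v => V (Q (pfst v))) (fun _ v => ⟨pfst (pfst v), ⟨Q (pfst v), psnd v⟩⟩) Ht _ _ _).
      + apply (computable_apply2 (lift E') _ (fun _ v z => chi (jump (V (Q (pfst v)))) z)
          (fun _ x => pfst x) (fun _ x => psnd x)); [|effective|effective|auto].
        apply (computable_apply2 E' _ (fun _ u z => chi (jump (V (Q u))) z)
          (fun _ x => pfst (pfst x)) (fun _ x => psnd x) HVj); [effective|effective|auto].
      + unfold Q; effective.
      + intros Y v [[_ Hv] Hl]. unfold E1. autorewrite with pairs. split; [reflexivity|].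
        intros z. specialize (Hv (V (Q (pfst v))) ⟨Q (pfst v), z⟩).
        autorewrite with pairs in Hv. apply Hv; [reflexivity|].
        apply Nat.ltb_ge in Hl. unfold Q. rewrite psnd_pair. lia.
    - intros Y v _. cbv beta. apply chi_iff. unfold enumerated_by, jump.
      autorewrite with pairs. now rewrite <- halts_Phi. }
  eapply computable_ext.
  - refine (computable_subst E' _ (fun _ u => jump (U (Q u))) _ (fun _ u => ⟨Q u, psnd (psnd u)⟩)
      HU HUj _ _).
    + unfold Q; effective.
    + intros Y u _. now rewrite pfst_pair.
  - intros Y u Hu. cbv beta. autorewrite with pairs. now rewrite (SQ Y u Hu).
Qed.

(** * The tower *)

Section Tower.
Variable e : nat.
Hypothesis e_self : self_enumerating e.

Definition extension (X : nset) (P : nat) : nat -> bool := built (entry X P) (halting_test X e P).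

Fixpoint tower (q k : nat) : nset :=
  match k with
  | 0 => empty_set
  | S k => join (tower q k) (extension (tower q k) ⟨q, k⟩)
  end.

Definition at_level (P : nat) : nset := tower (pfst P) (psnd P).

Lemma at_succ_level P : at_level (succ_level P) = join (at_level P) (extension (at_level P) P).
Proof.
  unfold at_level, succ_level. autorewrite with pairs. cbn [tower]. now autorewrite with pairs.
Qed.

(** The set controlled at one level is the set built at the next; this is where the
    self-reference of [e] is used. *)
Lemma outcome_extension X P j : outcome (entry X P) (halting_test X e P) j <->
  extension (join X (extension X P)) (succ_level P) j = true.
Proof.
  unfold extension at 1. rewrite built_true, <- (e_self (join X _)), <- halts_Phi.
  unfold outcome, halting_test.
  split; intros [w Hw]; exists w; rewrite <- Hw; apply halts_agree; intros z _;
    [|symmetry]; apply chi_join.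
Qed.

Lemma source_bit X P : source (entry X P) 0 <-> exists y, Phi (pfst P) X P y.
Proof. rewrite <- halts_Phi. reflexivity. Qed.

Lemma source_jump X P z : source (entry X P) (S z) <-> jump X z.
Proof. unfold jump. rewrite <- halts_Phi. reflexivity. Qed.

Lemma bit_coded P : at_level (succ_level P) ⟨1, ⟨0, 0⟩⟩ <->
  exists y, Phi (pfst P) (at_level P) P y.
Proof.
  rewrite <- source_bit, at_succ_level. rewrite (source_0_iff _ (halting_test (at_level P) e P)).
  unfold join, joined. autorewrite with pairs. cbn [Nat.eqb].
  fold (extension (at_level P) P). destruct (extension (at_level P) P ⟨0, 0⟩); cbn; easy.
Qed.

(** Two levels up, the oracle consists of [X], [built] and [outcome], and [stage] can be
    computed. *)
Lemma jump_below_tower :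
  computable_on (fun Y y => Y = at_level (succ_level (succ_level (pfst y))))
    (fun _ y => chi (jump (at_level (pfst y))) (psnd y)).
Proof.
  set (D := fun Y y => Y = at_level (succ_level (succ_level (pfst y)))).
  set (Z := fun y => at_level (pfst y)).
  assert (HZ : computable_on (lift D) (fun Y u => chi (Z (pfst u)) (psnd u))).
  { apply computable_ext with (G := fun Y u => chi Y ⟨0, ⟨0, psnd u⟩⟩); [effective|].
    intros Y u ->. rewrite at_succ_level, chi_join, at_succ_level. unfold joined.
    autorewrite with pairs. cbn [Nat.eqb]. rewrite chi_join. unfold joined.
    now autorewrite with pairs. }
  set (C := fun y => extension (Z y) (pfst y)).
  assert (HC : computable_on (lift D) (fun Y u => Nat.b2n (C (pfst u) (psnd u)))).
  { apply computable_ext with (G := fun Y u => chi Y ⟨0, ⟨1, psnd u⟩⟩); [effective|].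
    intros Y u ->. rewrite at_succ_level, chi_join, at_succ_level. unfold joined.
    autorewrite with pairs. cbn [Nat.eqb]. rewrite chi_join. unfold joined.
    now autorewrite with pairs. }
  set (U := fun y => extension (at_level (succ_level (pfst y))) (succ_level (pfst y))).
  assert (HU : computable_on (lift D) (fun Y u => Nat.b2n (U (pfst u) (psnd u)))).
  { apply computable_ext with (G := fun Y u => chi Y ⟨1, psnd u⟩); [effective|].
    intros Y u ->. rewrite at_succ_level, chi_join. unfold joined.
    now autorewrite with pairs. }
  assert (UW : forall y j, U y j = true <->
    outcome (entry (Z y) (pfst y)) (halting_test (Z y) e (pfst y)) j).
  { intros y j. rewrite outcome_extension. unfold U, Z. now rewrite at_succ_level. }
  set (st := fun y k => stage (entry (Z y) (pfst y)) (halting_test (Z y) e (pfst y)) (U y) (C y) k).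
  apply computable_ext with (G := fun _ y => Nat.b2n
    (entered (entry (Z y) (pfst y)) (S (psnd y)) (st y (S (S (psnd y)))))).
  2: { intros Y y _.
       assert (H : jump (Z y) (psnd y) <->
         entered (entry (Z y) (pfst y)) (S (psnd y)) (st y (S (S (psnd y)))) = true).
       { rewrite <- (source_jump _ (pfst y)).
         apply source_stage; [apply halting_test_use|apply UW]. }
       fold (Z y). destruct (entered _ _ _); [apply chi_true|apply chi_false]; now rewrite H. }
  apply (computable_entered_in D (fun _ y => Z y) (fun _ y => pfst y)); effective.
  apply (computable_rec D (fun _ y k => st y k) (fun _ y => S (S (psnd y))));
    [exact (computable_const D 0)| |effective].
  set (E := fun Y u => D Y (pfst u) /\ psnd (psnd u) = st (pfst u) (pfst (psnd u))).
  apply computable_ext with (G := fun _ u => mu (fun t =>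
     ready (entry (Z (pfst u)) (pfst (pfst u))) (halting_test (Z (pfst u)) e (pfst (pfst u)))
       (U (pfst u)) (C (pfst u)) (pfst (psnd u)) (psnd (psnd u)) t)).
  2: { intros Y u [_ H]. cbv beta. rewrite H. reflexivity. }
  apply (computable_mu E (fun _ u t =>
     ready (entry (Z (pfst u)) (pfst (pfst u))) (halting_test (Z (pfst u)) e (pfst (pfst u)))
       (U (pfst u)) (C (pfst u)) (pfst (psnd u)) (psnd (psnd u)) t)).
  2: { intros Y u [_ H]. rewrite H. apply ready_exists; [apply halting_test_use|apply UW|].
       apply stage_settled; [apply halting_test_use|apply UW]. }
  assert (lift_D : forall Y v, lift (lift E) Y v -> D Y (pfst (pfst (pfst v))))
    by (intros Y v [H _]; exact H).
  apply (computable_ready_in e (lift E) (fun _ v => Z (pfst (pfst v)))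
    (fun _ v => pfst (pfst (pfst v)))
    (fun _ v => U (pfst (pfst v))) (fun _ v => C (pfst (pfst v)))); [| | |effective..].
  - apply (computable_apply2 D _ (fun _ y z => chi (Z y) z) (fun _ v => pfst (pfst (pfst v)))
      (fun _ v => psnd v) HZ); [effective|effective|exact lift_D].
  - apply (computable_apply2 D _ (fun _ y z => Nat.b2n (U y z)) (fun _ v => pfst (pfst (pfst v)))
      (fun _ v => psnd v) HU); [effective|effective|exact lift_D].
  - apply (computable_apply2 D _ (fun _ y z => Nat.b2n (C y z)) (fun _ v => pfst (pfst (pfst v)))
      (fun _ v => psnd v) HC); [effective|effective|exact lift_D].
Qed.

(** The jump knows [source], hence for each [j] a stage after which the computation for [j]
    is not injured; whether a computation then exists is a Σ_1 question. *)
Lemma tower_below_jump :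
  computable_on (fun Y y => Y = jump (at_level (pfst y)))
    (fun _ y => chi (at_level (succ_level (succ_level (pfst y)))) (psnd y)).
Proof.
  set (D := fun Y y => Y = jump (at_level (pfst y))).
  set (Z := fun y => at_level (pfst y)).
  assert (HZ : computable_on (lift D) (fun Y u => chi (Z (pfst u)) (psnd u))).
  { eapply computable_ext.
    - refine (computable_sigma (lift D) (fun _ u => Z (pfst u)) (fun X u _ => chi X u =? 1)
        (fun _ u => psnd u) _ _ _); [effective|auto|effective].
    - intros Y u _. cbv beta. apply chi_iff. unfold enumerated_by.
      rewrite <- chi_eq1. setoid_rewrite Nat.eqb_eq.
      split; [intros H; exists 0; exact H|intros [_ H]; exact H]. }
  assert (HB : forall a, computable_on D a ->
    computable_on D (fun Y y => Nat.b2n (extension (Z y) (pfst y) (a Y y)))).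
  { intros a Ha. eapply computable_ext.
    - refine (computable_sigma D (fun _ => Z)
        (fun X u s => built_at (entry X (pfst u)) (halting_test X e (pfst u)) s (psnd u))
        (fun Y y => ⟨pfst y, a Y y⟩) _ _ _); [|auto|effective].
      apply (computable_built_at everywhere (fun _ _ => e)); effective.
    - intros Y y _. cbv beta. unfold extension.
      destruct (built _ _ (a Y y)) eqn:E; symmetry; [apply chi_true|apply chi_false];
        unfold enumerated_by; autorewrite with pairs; rewrite <- built_true; congruence. }
  set (Kb := fun y i => chi (source (entry (Z y) (pfst y))) i =? 1).
  assert (HK : computable_on (lift D) (fun Y u => Nat.b2n (Kb (pfst u) (psnd u)))).
  { unfold Kb. apply computable_eqb; [|effective]. eapply computable_ext.
    - refine (computable_sigma (lift D) (fun _ u => Z (pfst u))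
        (fun X u w => entry X (pfst u) (psnd u) w) (fun Y u => ⟨pfst (pfst u), psnd u⟩) _ _ _);
        [|auto|effective].
      apply computable_entry; effective.
    - intros Y u _. cbv beta. apply chi_iff. unfold enumerated_by. autorewrite with pairs.
      reflexivity. }
  set (ok := fun y s =>
    negb (exists_below (fun i => Kb y i && negb (entered (entry (Z y) (pfst y)) i s))
      (S (psnd (psnd y))))).
  assert (ok_settled : forall y s, ok y s = true <->
    settled (entry (Z y) (pfst y)) (S (psnd (psnd y))) s).
  { intros y s. unfold ok. rewrite settled_iff, negb_true_iff, <- not_true_iff_false,
      exists_below_true.
    split.
    - intros H i Hi HK'. destruct (entered _ i s) eqn:E; [reflexivity|].
      exfalso. apply H. exists i. split; [assumption|].
      rewrite E. unfold Kb. apply chi_eq1 in HK'. now rewrite HK'.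
    - intros H (i & Hi & E). apply andb_true_iff in E. destruct E as [E1 E2].
      unfold Kb in E1. rewrite Nat.eqb_eq, chi_eq1 in E1.
      now rewrite (H i Hi E1) in E2. }
  assert (Hs : computable_on D (fun _ y => mu (ok y))).
  { apply (computable_mu D (fun _ => ok)).
    2: { intros _ y _.
         destruct (settled_exists (entry (Z y) (pfst y)) (S (psnd (psnd y)))) as [s Hs].
         exists s. now apply ok_settled. }
    unfold ok. apply computable_negb.
    apply (computable_exists_below (lift D) (fun _ u i => Kb (pfst u) i &&
      negb (entered (entry (Z (pfst u)) (pfst (pfst u))) i (psnd u)))); [|effective].
    apply computable_andb; [|apply computable_negb].
    - apply (computable_apply2 D _ (fun _ y i => Nat.b2n (Kb y i)) (fun _ v => pfst (pfst v))
        (fun _ v => psnd v) HK); [effective|effective|auto].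
    - apply (computable_entered_in _ (fun _ v => Z (pfst (pfst v)))
        (fun _ v => pfst (pfst (pfst v))));
        [|effective..].
      apply (computable_apply2 D _ (fun _ y z => chi (Z y) z) (fun _ v => pfst (pfst (pfst v)))
        (fun _ v => psnd v) HZ); [effective|effective|auto]. }
  assert (HW : computable_on D (fun _ y =>
    chi (outcome (entry (Z y) (pfst y)) (halting_test (Z y) e (pfst y))) (psnd (psnd y)))).
  { eapply computable_ext.
    - refine (computable_sigma D (fun _ => Z)
        (fun X u n => (pfst (psnd u) <=? n) &&
           found (entry X (pfst u)) (halting_test X e (pfst u)) (psnd (psnd u)) n)
        (fun Y y => ⟨pfst y, ⟨mu (ok y), psnd (psnd y)⟩⟩) _ _ _); [|auto|effective].
      effective. apply (computable_found _ (fun _ _ => e)); effective.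
    - intros Y y _. cbv beta. apply chi_iff. unfold enumerated_by. autorewrite with pairs.
      apply outcome_iff_found; [apply halting_test_use|]. apply ok_settled. apply mu_spec.
      destruct (settled_exists (entry (Z y) (pfst y)) (S (psnd (psnd y)))) as [s Hs'].
      exists s. now apply ok_settled. }
  apply computable_ext with (G := fun _ y =>
    if pfst (psnd y) =? 0 then
      (if pfst (psnd (psnd y)) =? 0 then chi (Z y) (psnd (psnd (psnd y)))
       else Nat.b2n (extension (Z y) (pfst y) (psnd (psnd (psnd y)))))
    else chi (outcome (entry (Z y) (pfst y)) (halting_test (Z y) e (pfst y))) (psnd (psnd y))).
  - apply computable_if; [effective| |exact HW].
    apply computable_if; [effective| |apply HB; effective].
    apply (computable_apply2 D D (fun _ y z => chi (Z y) z) (fun _ y => y) _ HZ);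
      [effective|effective|auto].
  - intros Y y _. rewrite at_succ_level, chi_join, at_succ_level. unfold joined at 1.
    fold (Z y). destruct (pfst (psnd y) =? 0).
    + now rewrite chi_join.
    + pose proof (outcome_extension (Z y) (pfst y) (psnd (psnd y))) as Q.
      destruct (extension (join (Z y) (extension (Z y) (pfst y))) _ _); symmetry;
        [apply chi_true|apply chi_false]; rewrite Q; congruence.
Qed.

(** * Diagonalization *)

(** The common indexing of the jumps of ∅ (even levels) and of [A] (odd levels). *)
Definition iterated_jump (P : nat) : nset :=
  jumps (Nat.div2 (psnd P)) (if Nat.odd (psnd P) then at_level ⟨pfst P, 1⟩ else empty_set).

Lemma iterated_jump_step P : iterated_jump (succ_level (succ_level P)) = jump (iterated_jump P).
Proof. unfold iterated_jump, succ_level. now autorewrite with pairs. Qed.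

Lemma iterated_jump_base P : psnd P < 2 -> iterated_jump P = at_level P.
Proof.
  intros H. rewrite <- (pair_eta P). destruct (psnd P) as [|[|k]]; [| |lia];
    unfold iterated_jump; autorewrite with pairs; cbn; [|reflexivity].
  unfold at_level. now rewrite psnd_pair.
Qed.

Lemma iterated_jump_below_tower : below iterated_jump at_level.
Proof.
  apply below_ladder; [exact iterated_jump_base| |now apply jump_below_tower].
  apply computable_ext with (G := fun Y y => chi Y (psnd y)); [effective|].
  intros Y y ->. now rewrite iterated_jump_step.
Qed.

Lemma tower_below_iterated_jump : below at_level iterated_jump.
Proof.
  apply below_ladder; [symmetry; now apply iterated_jump_base|now apply tower_below_jump|].
  apply computable_ext with (G := fun Y y => chi Y (psnd y)); [effective|].
  intros Y y ->. now rewrite iterated_jump_step.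
Qed.

(** The procedure with index [q] computes the iterated jump from the tower and simulates
    Φ_m on it.  The reductions are the same for all [q], so there is no circularity in
    choosing [q] to be the index of a procedure that uses them. *)
Lemma diagonal_index : exists q, forall k,
  at_level ⟨q, S k⟩ ⟨1, ⟨0, 0⟩⟩ <->
  Phi (Nat.div2 k) (iterated_jump ⟨q, k⟩) (Nat.div2 k) 0.
Proof.
  (* Halving is written as a division by 4, which is known to be computable. *)
  set (m := fun P => 2 * psnd P / 4).
  assert (Em : forall P, m P = Nat.div2 (psnd P)).
  { intros P. unfold m. rewrite Nat.div2_div. apply (Nat.Div0.div_mul_cancel_l _ 2 2); lia. }
  destruct (semidecidable (fun X P => X = at_level P)
    (fun _ P w => run (chi (iterated_jump P)) w (m P) (m P) =? 1)) as [c Hc].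
  { apply computable_eqb; [|effective].
    apply (computable_run _ (fun _ y => chi (iterated_jump (pfst y))) (fun _ y => psnd y)
      (fun _ y => m (pfst y)) (fun _ y => m (pfst y))); [|effective|unfold m; effective..].
    eapply computable_ext.
    - refine (computable_comp _ _ (fun _ v => ⟨pfst (pfst v), psnd v⟩) _
        iterated_jump_below_tower _ _).
      + effective.
      + intros Y v Hv. rewrite pfst_pair. exact Hv.
    - intros Y v _. cbv beta. now autorewrite with pairs. }
  exists (encode c). intros k.
  replace ⟨encode c, S k⟩ with (succ_level ⟨encode c, k⟩)
    by (unfold succ_level; now autorewrite with pairs).
  rewrite bit_coded, pfst_pair.
  transitivity (exists y, eval (at_level ⟨encode c, k⟩) c ⟨encode c, k⟩ y).
  { split.
    - intros (y & d & Ed & H). apply encode_inj in Ed. subst d. eauto.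
    - intros (y & H). exists y, c. auto. }
  rewrite (Hc _ _ eq_refl), Em, psnd_pair. rewrite <- run_Phi.
  split; intros [w Hw]; exists w; now apply Nat.eqb_eq.
Qed.
End Tower.

Lemma iterated_jump_even e q n : iterated_jump e ⟨q, 2 * n⟩ = jumps n empty_set.
Proof.
  unfold iterated_jump. rewrite psnd_pair, Nat.div2_double, Nat.odd_even. reflexivity.
Qed.

Lemma iterated_jump_odd e q n :
  iterated_jump e ⟨q, S (2 * n)⟩ = jumps n (at_level e ⟨q, 1⟩).
Proof.
  unfold iterated_jump. autorewrite with pairs.
  rewrite Nat.div2_succ_double, Nat.odd_succ, Nat.even_even. reflexivity.
Qed.

Lemma jumps_jump n X : jumps n (jump X) = jumps (S n) X.
Proof. unfold jumps. now rewrite Nat.iter_succ_r. Qed.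

Lemma Delta_11 X S c : (forall n, eval (jumps n X) c n (chi S n)) -> Delta 1 1 X S.
Proof.
  intros H. exists (encode c). intros n. replace (1 * n + 1 - 1) with n by lia.
  split; intros HS; exists c; (split; [reflexivity|]); specialize (H n).
  - now rewrite chi_true in H.
  - now rewrite chi_false in H.
Qed.

(** At its own index, a functional that computed this set would be wrong. *)
Lemma not_Delta_11 X : ~ Delta 1 1 X (fun n => Phi n (jumps n X) n 0).
Proof.
  intros [i Hi]. specialize (Hi i). replace (1 * i + 1 - 1) with i in Hi by lia.
  destruct Hi as [H1 H0].
  assert (N : ~ Phi i (jumps i X) i 0).
  { intros H. specialize (H1 H). pose proof (Phi_fun _ _ _ _ _ H H1). discriminate. }
  auto.
Qed.

Lemma tower_ce e q : ce (at_level e ⟨q, 1⟩).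
Proof.
  destruct (semidecidable everywhere (fun X z s => negb (pfst z =? 0) &&
    built_at (entry X ⟨q, 0⟩) (halting_test X e ⟨q, 0⟩) s (psnd z))) as [c Hc].
  { effective. apply (computable_built_at _ (fun _ _ => e) (fun _ _ => ⟨q, 0⟩)); effective. }
  exists (encode c). intros z.
  transitivity (exists y, eval empty_set c z y).
  2: { split; [intros [y H]; exists y, c; auto|].
       intros (y & d & E & H). apply encode_inj in E. subst d. eauto. }
  rewrite (Hc empty_set z I). unfold at_level. autorewrite with pairs. cbn [tower].
  unfold join, joined. destruct (pfst z =? 0); cbn [negb andb].
  - rewrite chi_eq1. split; [intros []|intros [? ?]; discriminate].
  - unfold extension. rewrite <- built_true.
    destruct (built (entry empty_set ⟨q, 0⟩) (halting_test empty_set e ⟨q, 0⟩) (psnd z));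
      cbn; easy.
Qed.

Theorem theorem3p6 :
  exists A : nset, ce A /\ intermediate_for_Delta_Feiner A.
Proof.
  destruct self_enumerating_exists as [e He].
  destruct (diagonal_index e He) as [q Hq].
  set (A := at_level e ⟨q, 1⟩).
  (* [i = 0] compares A^(n) with ∅^(n), and [i = 1] compares ∅^(n+1) with A^(n). *)
  assert (HD : forall i, exists c, forall n Y, Y = iterated_jump e ⟨q, S (i + 2 * n)⟩ ->
    eval Y c n (chi (fun n => at_level e ⟨q, S (i + 2 * n)⟩ ⟨1, ⟨0, 0⟩⟩) n)).
  { intros i.
    destruct (computable_comp (fun Y n => Y = iterated_jump e ⟨q, S (i + 2 * n)⟩) _
      (fun _ n => ⟨⟨q, S (i + 2 * n)⟩, ⟨1, ⟨0, 0⟩⟩⟩) _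
      (tower_below_iterated_jump e He)) as [c Hc].
    - effective.
    - intros Y n HY. now rewrite pfst_pair.
    - exists c. intros n Y HY. specialize (Hc Y n HY). cbv beta in Hc.
      autorewrite with pairs in Hc. exact Hc. }
  exists A. split.
  - apply tower_ce.
  - exists 1, 1. split; [lia|]. split.
    + intros L. apply (not_Delta_11 empty_set). apply L.
      destruct (HD 0) as [c Hc]. apply Delta_11 with c. intros n.
      specialize (Hc n (jumps n A)). cbn [Nat.add] in Hc. rewrite iterated_jump_odd in Hc.
      specialize (Hc eq_refl).
      erewrite chi_iff; [exact Hc|]. cbv beta. rewrite Hq, iterated_jump_even, Nat.div2_double.
      reflexivity.
    + intros H. apply (not_Delta_11 A). apply H.
      destruct (HD 1) as [c Hc]. apply Delta_11 with c. intros n.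
      specialize (Hc n (jumps n (jump empty_set))). rewrite jumps_jump in *.
      replace (S (1 + 2 * n)) with (2 * S n) in Hc at 1 by lia. rewrite iterated_jump_even in Hc.
      specialize (Hc eq_refl).
      erewrite chi_iff; [exact Hc|]. cbv beta. rewrite Hq. cbn [Nat.add].
      rewrite iterated_jump_odd, Nat.div2_succ_double. reflexivity.
Qed.
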